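(* Let $r\geq 3$, $k_1\geq k_2\geq\cdots\geq k_r\geq t+2$ and $n\geq 5-k_1+2k_1\log_2 k_1$. If $\mathcal{F}_1\subseteq\Pi(n,k_1),\ldots,\mathcal{F}_r\subseteq\Pi(n,k_r)$ are non-trivial $r$-cross $t$-intersecting, then $$\prod_{i=1}^r|\mathcal{F}_i|\leq\Big((t+1)S(n-t,k_r-t)-t\,S(n-t-1,k_r-t-1)\Big)\prod_{i=1}^{r-1}S(n-t-1,k_i-t-1).$$ If equality holds, then there are $a\in[r]$ with $k_a=k_r$ and a partition $T$ consisting of $t+1$ singletons such that $\mathcal{F}_a=\{F\in\Pi(n,k_a):|T\cap F|\geq t\}$ and $\mathcal{F}_i=\{F\in\Pi(n,k_i):T\subseteq F\}$ for each $i\in[r]\setminus\{a\}$.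
   Context: All letters denote positive integers. $[n]=\{1,\ldots,n\}$. A partition is a set of pairwise disjoint nonempty sets (blocks). $\Pi(n,k)$ is the set of all partitions of $[n]$ into $k$ blocks; $S(n,k)=|\Pi(n,k)|$ (Stirling number of the second kind), with $S(n,a)=0$ for $a\leq 0$. For partitions $F,G$, $F\cap G$ is the set of common blocks. Families $\mathcal{F}_i\subseteq\Pi(n,k_i)$, $i\in[r]$, are $r$-cross $t$-intersecting if $|F_1\cap\cdots\cap F_r|\geq t$ for all $F_i\in\mathcal{F}_i$; they are non-trivial if the set of blocks belonging to every member of every $\mathcal{F}_i$ has fewer than $t$ elements. *)

(* Defs.v *)
From mathcomp Require Import all_boot.
From Stdlib Require Reals.

Set Implicit Arguments.
Unset Strict Implicit.
Unset Printing Implicit Defensive.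

(* [n] is modelled by 'I_n = {0,...,n-1}; a block is a {set 'I_n};
   a partition of [n] is a set of blocks which is a MathComp [partition]
   of the whole set (pairwise disjoint, nonempty blocks, covering [n]). *)
Definition Pi (n k : nat) : {set {set {set 'I_n}}} :=
  [set P : {set {set 'I_n}} | partition P [set: 'I_n] & #|P| == k].

Definition stirling (n k : nat) : nat := #|Pi n k|.

Definition cross_intersecting (n r t : nat)
  (F : nat -> {set {set {set 'I_n}}}) : Prop :=
  forall G : nat -> {set {set 'I_n}},
    (forall i, 1 <= i <= r -> G i \in F i) ->
    t <= #|\bigcap_(1 <= i < r.+1) G i|.

Definition common_blocks (n r : nat) (F : nat -> {set {set {set 'I_n}}})
  : {set {set 'I_n}} :=
  [set B : {set 'I_n} | all (fun i => [forall G in F i, B \in G]) (iota 1 r)].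

Definition nontrivial (n r t : nat) (F : nat -> {set {set {set 'I_n}}}) : Prop :=
  #|common_blocks r F| < t.

Definition log_cond (n k1 : nat) : Prop :=
  (Rdefinitions.Rle
     (Rdefinitions.Rplus
        (Rdefinitions.Rminus (Raxioms.INR 5) (Raxioms.INR k1))
        (Rdefinitions.Rmult (Rdefinitions.Rmult (Raxioms.INR 2) (Raxioms.INR k1))
           (Rdefinitions.Rdiv (Rpower.ln (Raxioms.INR k1)) (Rpower.ln (Raxioms.INR 2)))))
     (Raxioms.INR n)).

(* Main.v *)
(** Call a set of blocks a [t]-cover of some of the families if it shares at least [t] blocks
    with every common intersection of members chosen from them.

    Split the index set in two parts; each common intersection over one part is a [t]-cover of
    the other. If the minimum [t]-covers of the two sides have [t + x] and [t + z] blocks, then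
    choosing [t] blocks inside the minimum cover of one side and extending them one block at a
    time, by blocks of a member of the other side missed so far, bounds the number of choices
    on each side: every extension costs a factor of at most [K = k 1], while the hypothesis on
    [n] makes the number of partitions of [n] containing given blocks drop by a factor of at
    least [2 * K ^ 2] for each further block.

    If some family [a] has no common [t]-set, the remaining families are
    [(t+1)]-cross-intersecting, hence have at most [prod S(n-t-1, k_i-t-1)] choices; the family
    [a] then has either too few members, or all of its members share [t] blocks with one
    [(t+1)]-set contained in all other members, which is the extremal configuration. If every
    family has a common [t]-set, non-triviality forces the product below
    [K ^ 2 * prod S(n-t-1, k_i-t-1)], which is less than the bound.

    Families with [k_i = t + 2] need separate care because [t + 1] blocks already determine a
    partition, so the factor [2 * K ^ 2] is lost at the last step.

    Log-concavity of [l! * S(N, l)] shows that the distinguished family should have the least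
    [k_i]. *)
Require Import Defs.
From mathcomp Require Import all_boot zify.
From Stdlib Require Import Lra.
From Stdlib Require Reals.

Set Implicit Arguments.
Unset Strict Implicit.
Unset Printing Implicit Defensive.

(** * Stirling numbers of the second kind *)

Lemma disjoint_setDr (T : finType) (A B : {set T}) : [disjoint A & B :\: A].
Proof. by rewrite disjoint_sym disjoints_subset setDE subsetIr. Qed.

Section PartitionSurgery.

Variable T : finType.
Implicit Types (D E B C : {set T}) (P Q A : {set {set T}}).

Lemma partition_sub P D A : partition P D -> A \subset P -> partition A (cover A).
Proof.
move=> pP sAP; rewrite /partition eqxx (trivIsetS sAP (partition_trivIset pP)) /=.
by apply: contraFN (partition0 pP) => /(subsetP sAP).
Qed.

Lemma partitionD P D A :
  partition P D -> A \subset P -> partition (P :\: A) (D :\: cover A).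
Proof.
move=> pP sAP; have [coverP tiP P0] := and3P pP.
rewrite /partition trivIsetD // inE (negbTE P0) andbF /= andbT.
have dis : [disjoint cover A & cover (P :\: A)].
  apply/pred0P => y /=; apply/negP => /andP[/bigcupP[B BA yB] /bigcupP[C]].
  rewrite inE => /andP[nCA CP] yC; move: nCA; rewrite -(def_pblock tiP CP yC).
  by rewrite (def_pblock tiP (subsetP sAP B BA) yB) BA.
rewrite -(eqP coverP) -{2}(setID P A) (setIidPr sAP) /cover bigcup_setU -!/(cover _).
by rewrite setDUl setDv set0U [eqbRHS](setDidPl _) ?eqxx // disjoint_sym.
Qed.

Lemma partitionU P D A E :
  partition A E -> partition P D -> [disjoint E & D] -> partition (A :|: P) (E :|: D).
Proof.
case/and3P=> /eqP coverA tiA A0 /and3P[/eqP coverP tiP P0] dis.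
rewrite /partition /cover bigcup_setU -!/(cover _) coverA coverP eqxx inE negb_or A0 P0 /= andbT.
by apply: trivIsetU; rewrite ?coverA ?coverP.
Qed.

Lemma notin_partition P D B : partition P D -> ~~ (B \subset D) -> B \notin P.
Proof. by move=> pP; apply: contra => /(partitionS pP). Qed.

Lemma disjoint_partitions P D A E :
  partition A E -> partition P D -> [disjoint E & D] -> [disjoint A & P].
Proof.
move=> pA pP dis; apply/pred0P => B /=; apply/negP => /andP[BA BP].
have /set0Pn[y yB] := partition_neq0 pA BA.
have yE := subsetP (partitionS pA BA) y yB.
by have := subsetP (partitionS pP BP) y yB; rewrite (disjointFr dis yE).
Qed.

Definition replace_block C C' Q := C' |: (Q :\ C).

Lemma replace_blockK C C' Q : C \in Q -> C' \notin Q :\ C ->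
  replace_block C' C (replace_block C C' Q) = Q.
Proof. by move=> CQ nC'; rewrite /replace_block setU1K // setD1K. Qed.

Lemma partition_replace_block Q D C C' : partition Q D -> C \in Q -> C' != set0 ->
    [disjoint C' & D :\: C] ->
  partition (replace_block C C' Q) (C' :|: (D :\: C)) /\ C' \notin Q :\ C.
Proof.
move=> pQ CQ C'0 dis; have pD := partitionD1 pQ CQ; split; first exact: partitionU1.
apply: notin_partition pD _; apply: contra C'0 => sC'.
by rewrite -(setIidPl sC') setI_eq0.
Qed.

Lemma card_replace_block C C' Q : C \in Q -> C' \notin Q :\ C ->
  #|replace_block C C' Q| = #|Q|.
Proof. by move=> CQ nC'; rewrite cardsU1 nC' [RHS](cardsD1 C) CQ. Qed.

End PartitionSurgery.

Section Kpartitions.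

Variable T : finType.
Implicit Types (k : nat) (x : T) (D B C : {set T}) (P Q A : {set {set T}}).

Definition kpartitions D k : {set {set {set T}}} :=
  [set P | partition P D & #|P| == k].

Lemma kpartitionsP D k P :
  reflect (partition P D /\ #|P| = k) (P \in kpartitions D k).
Proof. by rewrite inE; apply: (iffP andP) => -[h /eqP]. Qed.

Lemma card_kpartitions_above D k A :
    partition A (cover A) -> cover A \subset D -> #|A| <= k ->
  #|[set P in kpartitions D k | A \subset P]| =
    #|kpartitions (D :\: cover A) (k - #|A|)|.
Proof.
move=> pA sAD cA; set D' := D :\: cover A.
have dis : [disjoint cover A & D'] by apply: disjoint_setDr.
have addK : {in kpartitions D' (k - #|A|), cancel (setU A) (fun P => P :\: A)}.
  move=> Q /kpartitionsP[pQ _]; rewrite setDUl setDv set0U (setDidPl _) // disjoint_sym.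
  exact: disjoint_partitions pA pQ dis.
rewrite -(card_in_imset (can_in_inj addK)); apply: eq_card => P.
rewrite inE; apply/andP/imsetP => [[/kpartitionsP[pP cP] sAP]|[Q Qp ->]].
  exists (P :\: A); last by rewrite -{1}(setID P A) (setIidPr sAP).
  by apply/kpartitionsP; rewrite cardsD (setIidPr sAP) cP; split=> //; apply: partitionD.
rewrite subsetUl; split=> //; have [pQ cQ] := kpartitionsP _ _ _ Qp.
apply/kpartitionsP; split.
  by have := partitionU pA pQ dis; rewrite -{1}(setIidPr sAD) setID.
rewrite cardsU (disjoint_setI0 (disjoint_partitions pA pQ dis)) cards0 subn0 cQ.
exact: subnKC.
Qed.

Lemma card_kpartitions_with_set1 D k x : x \in D ->
  #|[set P in kpartitions D k.+1 | [set x] \in P]| = #|kpartitions (D :\ x) k|.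
Proof.
move=> xD; have cover_x : cover [set [set x]] = [set x] by rewrite cover1.
have := @card_kpartitions_above D k.+1 [set [set x]].
rewrite cover_x cards1 subSS subn0 sub1set xD => <- //; last first.
  by rewrite /partition cover_x eqxx trivIset1 inE eq_sym -cards_eq0 cards1.
by apply: eq_card => P; rewrite !inE sub1set.
Qed.

Definition pointed_kpartitions D k : {set {set {set T}} * {set T}} :=
  [set QC | (QC.1 \in kpartitions D k) && (QC.2 \in QC.1)].

Lemma card_pointed_kpartitions D k :
  #|pointed_kpartitions D k| = k * #|kpartitions D k|.
Proof.
rewrite -sum1_card (eq_bigl _ _ (in_set _)).
rewrite -(pair_big_dep (mem (kpartitions D k)) (fun Q C => C \in Q) (fun _ _ => 1)) /=.
by rewrite mulnC -sum_nat_const; apply: eq_bigr => Q /kpartitionsP[_ <-]; rewrite sum1_card.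
Qed.

(* Deleting [x] from its block [x |: C] leaves a partition of [D :\ x] pointed at [C]. *)
Definition insert_point x (QC : {set {set T}} * {set T}) :=
  replace_block QC.2 (x |: QC.2) QC.1.

Definition delete_point x P :=
  (replace_block (pblock P x) (pblock P x :\ x) P, pblock P x :\ x).

Lemma insert_pointK D k x QC : x \in D -> QC \in pointed_kpartitions (D :\ x) k ->
  [/\ insert_point x QC \in kpartitions D k, [set x] \notin insert_point x QC
    & delete_point x (insert_point x QC) = QC].
Proof.
case: QC => Q C xD; rewrite inE => /andP[/= /kpartitionsP[pQ cQ] CQ].
have sCD := partitionS pQ CQ.
have xC : x \notin C by apply/negP => /(subsetP sCD); rewrite !inE eqxx.
have [||pP nxC] := @partition_replace_block _ Q (D :\ x) C (x |: C) pQ CQ.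
- by apply/set0Pn; exists x; rewrite setU11.
- by rewrite disjoints_subset subUset sub1set !inE eqxx andbF /= subsetC setDE subsetIr.
have DE : (x |: C) :|: (D :\ x :\: C) = D.
  by rewrite -setUA -{1}(setIidPr sCD) setID setD1K.
rewrite DE in pP.
have pblockE : pblock (replace_block C (x |: C) Q) x = x |: C.
  by apply: def_pblock (partition_trivIset pP) _ _; rewrite setU11.
rewrite /insert_point /delete_point /= pblockE setU1K // replace_blockK //; split=> //.
  by apply/kpartitionsP; rewrite card_replace_block.
apply: contraNN xC => xP; have := def_pblock (partition_trivIset pP) xP (set11 x).
rewrite pblockE => /setP xE; have /set0Pn[y yC] := partition_neq0 pQ CQ.
by have := xE y; rewrite !inE yC orbT => /esym/eqP <-.
Qed.

Lemma delete_pointK D k x P : x \in D -> P \in kpartitions D k -> [set x] \notin P ->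
  delete_point x P \in pointed_kpartitions (D :\ x) k /\
  insert_point x (delete_point x P) = P.
Proof.
move=> xD /kpartitionsP[pP cP] nxP.
have x_cov : x \in cover P by rewrite (cover_partition pP).
have BP : pblock P x \in P by apply: pblock_mem.
have xB : x \in pblock P x by rewrite mem_pblock.
have [||pQ nB] := @partition_replace_block _ P D _ (pblock P x :\ x) pP BP.
- apply: contraNneq nxP => /eqP; rewrite setD_eq0 subset1 => /orP[/eqP <- //|/eqP B0].
  by rewrite B0 inE in xB.
- by rewrite disjoints_subset setCD (subset_trans (subsetDl _ _)) // subsetUr.
rewrite /insert_point /delete_point /= setD1K ?replace_blockK //; split=> //.
rewrite inE /= setU11 andbT; apply/kpartitionsP; rewrite card_replace_block //; split=> //.
have DE : D :\ x = (pblock P x :\ x) :|: (D :\: pblock P x).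
  apply/setP => y; rewrite !inE; have [->|_] //= := eqVneq y x; first by rewrite xB.
  by have := subsetP (partitionS pP BP) y; case: (y \in pblock P x) => //= ->.
by rewrite DE.
Qed.

Lemma card_kpartitions_without_set1 D k x : x \in D ->
  #|[set P in kpartitions D k | [set x] \notin P]| = k * #|kpartitions (D :\ x) k|.
Proof.
move=> xD; rewrite -card_pointed_kpartitions.
have insK : {in pointed_kpartitions (D :\ x) k, cancel (insert_point x) (delete_point x)}.
  by move=> QC /(insert_pointK xD)[].
rewrite -(card_in_imset (can_in_inj insK)); apply: eq_card => P; rewrite inE.
apply/andP/imsetP => [[Pp nxP]|[QC QCp ->]].
  by have [QCp PE] := delete_pointK xD Pp nxP; exists (delete_point x P).
by have [] := insert_pointK xD QCp.
Qed.

Lemma card_kpartitionsS D k x : x \in D ->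
  #|kpartitions D k.+1| = k.+1 * #|kpartitions (D :\ x) k.+1| + #|kpartitions (D :\ x) k|.
Proof.
move=> xD; rewrite -card_kpartitions_without_set1 // -card_kpartitions_with_set1 // addnC.
rewrite -(cardsID [set P : {set {set T}} | [set x] \in P]).
by congr (_ + _); apply: eq_card => P; rewrite !inE // andbC.
Qed.

Lemma card_kpartitions0 D : #|kpartitions D 0| = (D == set0).
Proof.
case: eqP => [->|D0]; [apply/eqP/cards1P; exists set0 | apply: eq_card0] => //.
  by apply/setP => P; rewrite !inE partition_set0 cards_eq0 andbb.
move=> P; rewrite !inE cards_eq0; apply/andP => -[pP /eqP P0]; apply: D0.
by rewrite -(cover_partition pP) P0 /cover big_set0.
Qed.

Lemma card_kpartitions_set0 k : #|kpartitions set0 k.+1| = 0.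
Proof.
apply: eq_card0 => P; rewrite !inE partition_set0.
by case: eqP => [->|//]; rewrite cards0.
Qed.

End Kpartitions.

Lemma eq_card_kpartitions (T U : finType) (D : {set T}) (E : {set U}) k :
  #|D| = #|E| -> #|kpartitions D k| = #|kpartitions E k|.
Proof.
move cE: #|E| => n cD; elim: n k D E cD cE => [|n IHn] [|k] D E cD cE.
- by rewrite !card_kpartitions0 -!cards_eq0 cD cE.
- have -> : D = set0 by apply/eqP; rewrite -cards_eq0 cD.
  have -> : E = set0 by apply/eqP; rewrite -cards_eq0 cE.
  by rewrite !card_kpartitions_set0.
- by rewrite !card_kpartitions0 -!cards_eq0 cD cE.
have /card_gt0P[x xD] : 0 < #|D| by rewrite cD.
have /card_gt0P[y yE] : 0 < #|E| by rewrite cE.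
have cDx : #|D :\ x| = n by move: cD; rewrite (cardsD1 x) xD => -[].
have cEy : #|E :\ y| = n by move: cE; rewrite (cardsD1 y) yE => -[].
by rewrite (card_kpartitionsS _ xD) (card_kpartitionsS _ yE) !(IHn _ _ _ cDx cEy).
Qed.

Lemma card_kpartitions (T : finType) (D : {set T}) k :
  #|kpartitions D k| = stirling #|D| k.
Proof. by apply: eq_card_kpartitions; rewrite cardsT card_ord. Qed.

Arguments stirling : simpl never.

Lemma stirling0 k : stirling 0 k = (k == 0).
Proof.
have <- : #|kpartitions (set0 : {set void}) k| = stirling 0 k.
  by rewrite card_kpartitions cards0.
by case: k => [|k]; rewrite ?card_kpartitions0 ?eqxx ?card_kpartitions_set0.
Qed.

Lemma stirlingn0 n : stirling n.+1 0 = 0.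
Proof.
by rewrite -(card_ord n.+1) -cardsT -card_kpartitions card_kpartitions0 -cards_eq0 cardsT card_ord.
Qed.

Lemma stirlingS n k : stirling n.+1 k.+1 = k.+1 * stirling n k.+1 + stirling n k.
Proof.
rewrite -{1}(card_ord n.+1) -cardsT -card_kpartitions (card_kpartitionsS _ (in_setT ord0)).
by rewrite !card_kpartitions setTD cardsC1 card_ord.
Qed.

Lemma stirling_small n k : n < k -> stirling n k = 0.
Proof.
elim: n k => [|n IHn] [|k] //; first by rewrite stirling0.
by rewrite ltnS => nk; rewrite stirlingS !IHn ?muln0 // ltnW.
Qed.

Lemma stirling_gt0 n k : 0 < k <= n -> 0 < stirling n k.
Proof.
elim: n k => [|n IHn] [|k] // kn; rewrite stirlingS addn_gt0 muln_gt0 /=.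
have [kn'|nk] := leqP k.+1 n; first by rewrite IHn.
have -> : k = n by lia.
apply/orP; right; case: n {nk kn} IHn => [|n] IHn; first by rewrite stirling0.
by apply: IHn; rewrite /= leqnn.
Qed.

Lemma stirlingn1 n : stirling n.+1 1 = 1.
Proof. by elim: n => [|n IHn]; rewrite stirlingS ?IHn ?stirlingn0 ?stirling0. Qed.

Lemma leq_stirlingn1 n : stirling n 1 <= 1.
Proof. by case: n => [|n]; rewrite ?stirling0 ?stirlingn1. Qed.

Lemma stirlingn2 n : stirling n.+1 2 = 2 ^ n - 1.
Proof.
elim: n => [|n IHn]; first by rewrite stirlingS !stirling0.
by rewrite stirlingS IHn stirlingn1 expnS; have := expn_gt0 2 n; lia.
Qed.

Lemma leq_stirlingl m n k : 0 < k -> m <= n -> stirling m k <= stirling n k.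
Proof.
case: k => // k _; elim: n => [|n IHn]; first by case: m.
by rewrite leq_eqVlt => /predU1P[-> //|/IHn mn]; rewrite stirlingS; nia.
Qed.

Lemma leq_stirlingS n k : stirling n k <= stirling n.+1 k.+1.
Proof. by rewrite stirlingS leq_addl. Qed.

Lemma leq_double_stirling n k : 1 < k -> 2 * stirling n k <= stirling n.+1 k.
Proof. by case: k => // k k_gt1; rewrite stirlingS; nia. Qed.

Lemma leq_stirlingD m n k : 1 < k -> 0 < m -> 0 < n ->
  stirling m k + stirling n k <= stirling (m + n).-1 k.
Proof.
move=> k_gt1; wlog nm : m n / n <= m => [wlog_nm m_gt0 n_gt0|m_gt0 n_gt0].
  have [/wlog_nm|/ltnW/wlog_nm] := leqP n m; first by apply.
  by rewrite addnC [m + n]addnC; apply.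
have [n_le1|n_gt1] := leqP n 1; last first.
  apply: (@leq_trans (stirling m.+1 k)); last by apply: leq_stirlingl; lia.
  apply: leq_trans (leq_double_stirling _ k_gt1).
  by have := @leq_stirlingl n m k; lia.
have -> : n = 1 by lia.
by rewrite [stirling 1 k]stirling_small // addn0 addn1.
Qed.

Lemma leq_sum_stirling (I : finType) (S : {set I}) (p : I -> nat) k : 1 < k ->
    {in S, forall i, 0 < p i} ->
  \sum_(i in S) stirling (p i) k <= stirling ((\sum_(i in S) p i).+1 - #|S|) k.
Proof.
move=> k_gt1; move cS: #|S| => m; elim: m S cS => [|m IHm] S cS p_gt0.
  by move/eqP: cS; rewrite cards_eq0 => /eqP ->; rewrite !big_set0.
have /card_gt0P[i iS] : 0 < #|S| by rewrite cS.
have cSi : #|S :\ i| = m by move: cS; rewrite (cardsD1 i) iS => -[].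
have p_gt0' : {in S :\ i, forall j, 0 < p j}.
  by move=> j; rewrite inE => /andP[_ /p_gt0].
have leS : m <= \sum_(j in S :\ i) p j by rewrite -cSi -sum1_card; apply: leq_sum.
rewrite !(big_setD1 i iS) /=; apply: leq_trans (leq_add (leqnn _) (IHm _ cSi p_gt0')) _.
have rest_gt0 : 0 < (\sum_(j in S :\ i) p j).+1 - m by rewrite subn_gt0.
apply: leq_trans (leq_stirlingD k_gt1 (p_gt0 i iS) rest_gt0) _.
by apply: leq_stirlingl; lia.
Qed.

Definition nsurj n k := k`! * stirling n k.

Lemma nsurjS n k : nsurj n.+1 k.+1 = k.+1 * (nsurj n k.+1 + nsurj n k).
Proof. by rewrite /nsurj stirlingS factS; lia. Qed.

Lemma nsurjn0 n : nsurj n.+1 0 = 0. Proof. by rewrite /nsurj stirlingn0 muln0. Qed.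

Lemma nsurj_gt0 n k : 0 < k <= n -> 0 < nsurj n k.
Proof. by move=> h; rewrite muln_gt0 fact_gt0 stirling_gt0. Qed.

Lemma log_concave_consecutive_sums (f : nat -> nat) i j :
    (forall i j, i <= j -> f i * f j.+1 <= f i.+1 * f j) -> i <= j ->
  (f i.+1 + f i) * (f j.+2 + f j.+1) <= (f i.+2 + f i.+1) * (f j.+1 + f j).
Proof.
move=> lcf ij; have ij_outer : f i * f j.+2 <= f i.+2 * f j.
  move: ij; rewrite leq_eqVlt => /predU1P[->|ij]; first by rewrite mulnC.
  by apply: leq_trans (lcf _ _ _) (lcf _ _ ij); lia.
have := lcf i.+1 j.+1 ij; have := lcf i j ij.
by rewrite !mulnDl !mulnDr; lia.
Qed.

Lemma nsurj_log_concave n i j : i <= j ->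
  nsurj n i * nsurj n j.+1 <= nsurj n i.+1 * nsurj n j.
Proof.
elim: n i j => [|n IHn] i j ij; first by rewrite /nsurj [stirling 0 j.+1]stirling0 !muln0.
case: i j ij => [|i] [|j] ij //; rewrite ?nsurjn0 ?mul0n ?muln0 // !nsurjS.
rewrite mulnACA [leqRHS]mulnACA leq_mul //; first by nia.
exact: log_concave_consecutive_sums.
Qed.

Lemma nsurj_log_concave_lt n i j : i < j <= n ->
  nsurj n i * nsurj n j.+1 < nsurj n i.+1 * nsurj n j.
Proof.
case: n => [|n]; first by case: j => // j; rewrite andbF.
case: i j => [|i] [|j] // /andP[ij jn].
  by rewrite nsurjn0 mul0n muln_gt0 !nsurj_gt0.
rewrite !nsurjS mulnACA [ltnRHS]mulnACA.
have sums_le := @log_concave_consecutive_sums _ i j (@nsurj_log_concave n) (ltnW ij).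
apply: leq_ltn_trans (leq_mul (leqnn _) sums_le) _.
rewrite ltn_pmul2r; first by nia.
by rewrite muln_gt0 !addn_gt0 [0 < nsurj n i.+1]nsurj_gt0 ?[0 < nsurj n j]nsurj_gt0 ?orbT //; lia.
Qed.

Lemma mul_nsurj n i j :
  nsurj n i * nsurj n j.+1 = i`! * j`! * (stirling n i * (j.+1 * stirling n j.+1)).
Proof. by rewrite /nsurj factS; lia. Qed.

Lemma leq_stirling_ratio n i j : i <= j ->
  stirling n.+1 j.+1 * stirling n i <= stirling n.+1 i.+1 * stirling n j.
Proof.
move/(nsurj_log_concave n); rewrite [leqRHS]mulnC !mul_nsurj [j`! * _]mulnC.
by rewrite leq_pmul2l ?muln_gt0 ?fact_gt0 // !stirlingS; lia.
Qed.

Lemma ltn_stirling_ratio n i j : i < j <= n ->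
  stirling n.+1 j.+1 * stirling n i < stirling n.+1 i.+1 * stirling n j.
Proof.
move/nsurj_log_concave_lt; rewrite [ltnRHS]mulnC !mul_nsurj [j`! * _]mulnC.
by rewrite ltn_pmul2l ?muln_gt0 ?fact_gt0 // !stirlingS; lia.
Qed.

Lemma expn_sum_stirling k n : k ^ n = \sum_(j < k.+1) stirling n j * k ^_ j.
Proof.
elim: n => [|n IHn].
  by rewrite big_ord_recl big1 /= ?stirling0 // => i _; rewrite stirling0.
rewrite expnS IHn big_distrr [RHS]big_ord_recl stirlingn0 mul0n add0n /=.
have -> : \sum_(i < k) stirling n.+1 (bump 0 i) * k ^_ (bump 0 i) =
    \sum_(i < k) i.+1 * stirling n i.+1 * k ^_ i.+1 + \sum_(i < k) stirling n i * k ^_ i.+1.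
  by rewrite -big_split /=; apply: eq_bigr => i _; rewrite /bump add1n stirlingS mulnDl.
have -> : \sum_(i < k) i.+1 * stirling n i.+1 * k ^_ i.+1 =
    \sum_(i < k.+1) i * stirling n i * k ^_ i.
  by rewrite [RHS]big_ord_recl !mul0n add0n.
have -> : \sum_(i < k) stirling n i * k ^_ i.+1 = \sum_(i < k.+1) stirling n i * k ^_ i.+1.
  by rewrite [RHS]big_ord_recr /= ffact_small // muln0 addn0.
rewrite -big_split /=; apply: eq_bigr => i _; rewrite ffactnSr.
by have := ltn_ord i; rewrite ltnS => /subnKC {1}<-; lia.
Qed.

Lemma leq_nsurj_expn n k : nsurj n k <= k ^ n.
Proof. by rewrite expn_sum_stirling big_ord_recr /= ffactnn mulnC leq_addl. Qed.

Lemma leq_expn_nsurjD n k : k.+1 ^ n <= nsurj n k.+1 + k.+1 * k ^ n.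
Proof.
rewrite expn_sum_stirling big_ord_recr /= ffactnn mulnC addnC leq_add2l.
rewrite expn_sum_stirling big_distrr /=; apply: leq_sum => j _.
by rewrite mulnCA leq_mul // -ffactSS ffactnSr leq_pmulr // subn_gt0.
Qed.

Lemma leq_mul_stirlingS c n k :
  (c + k.+1) * k ^ n <= k.+1 ^ n -> c * stirling n k <= stirling n.+1 k.+1.
Proof.
rewrite mulnDl => growth.
have: c * nsurj n k <= nsurj n k.+1.
  have := leq_expn_nsurjD n k; have := leq_mul (leqnn c) (leq_nsurj_expn n k); lia.
rewrite /nsurj factS mulnCA -mulnA [leqRHS]mulnCA leq_pmul2l ?fact_gt0 // => /leq_trans; apply.
by rewrite stirlingS leq_addr.
Qed.

(** * The growth condition *)

(* The condition [5 - K + 2 K log_2 K <= n], exponentiated. *)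
Definition pow_cond n K := 32 * K ^ (2 * K) <= 2 ^ (n + K).

Section LogCondition.
Import Reals.

(* [Reals] rebinds this notation to [Nat.pow]. *)
Local Notation "m ^ n" := (expn m n) : nat_scope.

Lemma INR_expn m e : INR (m ^ e) = (INR m ^ e)%R.
Proof. by elim: e => [|e IHe] //; rewrite expnS -multE mult_INR IHe. Qed.

Lemma pow_cond_of_log_cond n K : 0 < K -> log_cond n K -> pow_cond n K.
Proof.
move=> K_gt0 log_nK; rewrite /pow_cond leqNgt; apply/negP => /ltP /lt_INR.
have INR_K : (0 < INR K)%R by apply: lt_0_INR; apply/ltP.
have INR_2 : (0 < INR 2)%R by simpl; lra.
have ln2_gt0 : (0 < ln (INR 2))%R by rewrite -ln_1; apply: ln_increasing; simpl; lra.
rewrite -[32]/(2 ^ 5) -multE mult_INR !INR_expn.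
move/(ln_increasing _ _ (pow_lt _ (n + K) INR_2)).
rewrite ln_mult; [|exact: pow_lt|exact: pow_lt].
rewrite !ln_pow // mult_INR -plusE plus_INR.
move: log_nK; rewrite /log_cond => /(Rmult_le_compat_r _ _ _ (Rlt_le _ _ ln2_gt0)).
have -> : ((INR 5 - INR K + INR 2 * INR K * (ln (INR K) / ln (INR 2))) * ln (INR 2) =
    INR 5 * ln (INR 2) - INR K * ln (INR 2) + INR 2 * INR K * ln (INR K))%R.
  by field; lra.
by move=> log_le ln_lt; lra.
Qed.

End LogCondition.

Lemma leq_wexp2r m n e : m <= n -> m ^ e <= n ^ e.
Proof. by case: e => [|e] mn; rewrite ?expn0 // leq_exp2r. Qed.

(* The first three terms of the binomial expansion already give the factor [5 / 2]. *)
Lemma leq_five_halves_expnS m : 5 * m ^ m.+1 <= 2 * m.+1 ^ m.+1.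
Proof.
case: m => [|m]; first by rewrite exp0n.
have bin2E : 'C(m.+2, 2) * 2 = m.+2 * m.+1 by rewrite (bin_ffact _ 2) ffactnS ffactn1.
have := expnDn m.+1 1 m.+2; rewrite addn1 => ->.
rewrite !big_ord_recl /bump /= !exp1n !muln1 bin0 bin1 !subSS !subn0 mul1n !expnS.
set rest := \sum_(i < _) _; move: (m.+1 ^ m) rest ('C(_, _)) bin2E => x rest c bin2E.
have : 2 * (c * x) = m.+2 * m.+1 * x by rewrite -bin2E; lia.
lia.
Qed.

Lemma leq_exp32_expnS m n : 32 ^ n * m ^ (4 * m.+1 * n) <= m.+1 ^ (4 * m.+1 * n).
Proof.
rewrite !(expnM _ (4 * m.+1)) -expnMn; apply: leq_wexp2r.
have := leq_wexp2r 4 (leq_five_halves_expnS m); rewrite !expnMn -!expnM ![m.+1 * 4]mulnC.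
by move: (m ^ _) (m.+1 ^ _) => x y; lia.
Qed.

(* [949] comes from [32 * (7/3) ^ 4 <= 949]; for [K >= 31] the claim is [949 <= K ^ 2]. *)
Lemma leq_exp949 K l : 3 <= K -> l <= K -> 949 ^ l <= 1024 * K ^ 10 * K ^ (2 * l).
Proof.
move=> K_ge3 lK; have [K_ge31|K_lt31] := leqP 31 K.
  apply: (@leq_trans (K ^ (2 * l))); last by rewrite leq_pmull // muln_gt0 expn_gt0; lia.
  by rewrite expnM; apply: leq_wexp2r; rewrite -mulnn; nia.
suff leK : 949 ^ K <= 1024 * K ^ 10 * K ^ (2 * K).
  rewrite -(@leq_pmul2r (K ^ (2 * (K - l)))); last by rewrite expn_gt0; lia.
  rewrite -[leqRHS]mulnA -expnD -mulnDr subnKC //; apply: leq_trans leK.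
  rewrite -[in leqRHS](subnKC lK) expnD leq_mul // expnM.
  by apply: leq_wexp2r; rewrite -mulnn; nia.
by move: K K_ge3 K_lt31 {l lK}; do 3! case=> //; do 28! (case; [lia|]); lia.
Qed.

Section Growth.

Variables n K : nat.
Hypothesis K_ge3 : 3 <= K.
Hypothesis nK : pow_cond n K.

Lemma pow_cond_leq_expn l : l < K -> K ^ (2 * l.+1) * 2 ^ (K + 3) <= 2 ^ (n + 2 * l).
Proof.
move=> lK; have [d KE] : exists d, K = l.+1 + d by exists (K - l.+1); lia.
rewrite -(@leq_pmul2r (2 ^ (2 * d))) ?expn_gt0 // -[leqRHS]expnD mulnAC.
have d_le : 2 ^ (2 * d) <= K ^ (2 * d) by apply: leq_wexp2r; lia.
apply: leq_trans (leq_mul (leq_mul (leqnn _) d_le) (leqnn _)) _.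
rewrite -expnD -mulnDr -KE -(@leq_pmul2l 4) // (_ : 4 = 2 ^ 2) // -expnD.
have -> : 2 + (n + 2 * l + 2 * d) = (n + K) + K by lia.
rewrite [leqRHS]expnD; apply: leq_trans (leq_mul nK (leqnn _)).
by rewrite expnD; lia.
Qed.

Lemma pow_cond_addn5_leq : K + 5 <= n.
Proof.
have := @pow_cond_leq_expn 0; rewrite muln0 addn0 => /(_ (ltn_trans (isT : 0 < 2) K_ge3)).
have: 2 ^ (K + 6) <= K ^ (2 * 1) * 2 ^ (K + 3).
  rewrite (expnD 2 K 6) (expnD 2 K 3) mulnCA leq_mul // muln1.
  by have := leq_wexp2r 2 K_ge3; lia.
by move/leq_trans=> pow_le /pow_le; rewrite leq_exp2l //; lia.
Qed.

Lemma pow_cond_leq_expn_sub l s : 0 < s -> l + s <= K ->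
  4 * K ^ (2 * l.+1) <= 2 ^ (n - s.+1 + l).
Proof.
move=> s_gt0 lsK; have nb := pow_cond_addn5_leq.
rewrite -(@leq_pmul2r (2 ^ (l + s.+1))) ?expn_gt0 // -expnD.
have -> : n - s.+1 + l + (l + s.+1) = n + 2 * l by lia.
apply: leq_trans (@pow_cond_leq_expn l _); last by lia.
rewrite mulnAC mulnC leq_mul // (_ : 4 = 2 ^ 2) // -expnD leq_exp2l //; lia.
Qed.

Lemma leq_mul_expn_expnS m s : 0 < s -> m.+1 + s <= K ->
  (2 * K ^ 2 + m.+1) * m ^ (n - s.+1) <= m.+1 ^ (n - s.+1).
Proof.
move=> s_gt0 msK; set l := m.+1; set c := 2 * K ^ 2 + l; set N := n - s.+1.
have c_le : 32 * c ^ 4 <= 949 * K ^ 8.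
  have: 3 * c <= 7 * K ^ 2 by rewrite /c /l -mulnn; nia.
  move/(leq_wexp2r 4); rewrite (expnMn 3) (expnMn 7) -expnM.
  by move: (c ^ 4) (K ^ (2 * 4)) => x y; lia.
have c_exp32 : c ^ (4 * l) <= 32 ^ N.
  rewrite -(@leq_pmul2l (32 ^ l)) ?expn_gt0 // expnM -expnMn.
  apply: leq_trans (leq_wexp2r l c_le) _; rewrite expnMn -expnM.
  have lK : l <= K by lia.
  apply: leq_trans (leq_mul (leq_exp949 K_ge3 lK) (leqnn _)) _.
  have := leq_wexp2r 5 (pow_cond_leq_expn_sub s_gt0 msK); rewrite (expnMn 4) -!expnM.
  rewrite (_ : 2 ^ _ = 32 ^ l * 32 ^ N); last by rewrite mulnC expnM -expnD addnC.
  have K_exp : K ^ 10 * K ^ (2 * l) * K ^ (8 * l) = K ^ (2 * l.+1 * 5).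
    by rewrite -!expnD; congr (_ ^ _); lia.
  by move/(leq_trans _); apply; rewrite -2!(mulnA 1024) K_exp.
have e_gt0 : 0 < 4 * l by [].
rewrite -(leq_exp2r _ _ e_gt0) expnMn -!expnM ![N * _]mulnC.
by apply: leq_trans (leq_exp32_expnS m N); apply: leq_mul.
Qed.

Lemma stirling_growth k s : 0 < s -> s + 2 <= k <= K ->
  2 * K ^ 2 * stirling (n - s.+1) (k - s.+1) <= stirling (n - s) (k - s).
Proof.
move=> s_gt0 /andP[sk kK]; have nb := pow_cond_addn5_leq.
have [-> ->] : n - s = (n - s.+1).+1 /\ k - s = (k - s.+1).+1 by lia.
by apply: leq_mul_stirlingS; apply: leq_mul_expn_expnS; lia.
Qed.

Lemma stirling2_growth k : k <= K -> (2 * K ^ 2) ^ 2 <= stirling (n - k + 2) 2.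
Proof.
move=> kK; have nb := pow_cond_addn5_leq; rewrite addn2 stirlingn2.
have := @pow_cond_leq_expn 2 K_ge3; rewrite (_ : n + 2 * 2 = (n - K).+1 + (K + 3)); last by lia.
rewrite (expnD 2 (n - K).+1) leq_pmul2r ?expn_gt0 // => K6.
have : 2 ^ (n - K).+1 <= 2 ^ (n - k).+1 by rewrite leq_exp2l //; lia.
move/(leq_trans K6) => {K6}; rewrite (expnMn 2) -expnM (expnD K 4 2).
have : 9 <= K ^ 2 by rewrite -mulnn; nia.
have : 0 < K ^ 4 by rewrite expn_gt0; lia.
by rewrite (_ : 2 * 2 = 4) //; move: (K ^ 4) (K ^ 2) (2 ^ _) => x y z; nia.
Qed.

Lemma stirling_decay k s x : 0 < s -> s + x + 2 <= k <= K ->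
  (2 * K ^ 2) ^ x * stirling (n - (s + x)) (k - (s + x)) <= stirling (n - s) (k - s).
Proof.
move=> s_gt0; elim: x => [|x IHx] sxk; first by rewrite mul1n addn0.
apply: leq_trans (IHx _); last by lia.
by rewrite expnSr -mulnA leq_mul // addnS; apply: stirling_growth; lia.
Qed.

Lemma leq_exp_stirling k s x : 0 < s -> s + 2 <= k <= K -> s + x <= k ->
  (2 * K ^ 2) ^ x <= stirling (n - s) (k - s).
Proof.
move=> s_gt0 sk xk; apply: (@leq_trans ((2 * K ^ 2) ^ (k - s))).
  by rewrite leq_pexp2l ?muln_gt0 ?expn_gt0; lia.
have nb := pow_cond_addn5_leq; have decay := @stirling_decay k s (k - s - 2) s_gt0.
have n_top : n - (s + (k - s - 2)) = n - k + 2 by lia.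
have k_top : k - (s + (k - s - 2)) = 2 by lia.
rewrite n_top k_top in decay.
rewrite [X in _ ^ X](_ : k - s = k - s - 2 + 2); last by lia.
rewrite expnD; apply: leq_trans (decay _); last by lia.
by rewrite leq_mul // stirling2_growth //; lia.
Qed.

Lemma leq_four_thirds_exp t : t + 3 <= K -> 0 < t ->
  2 * K * 3 ^ (n - t.+1) <= 4 ^ (n - t.+1).
Proof.
move=> tK t_gt0; have nb := pow_cond_addn5_leq; set N := n - t.+1.
have K8 : K ^ 8 <= 2 * 2 ^ N.
  rewrite -expnS -(@leq_pmul2r (2 ^ (K + 3))) ?expn_gt0 // -expnD.
  apply: leq_trans (@pow_cond_leq_expn 3 _) _; first by lia.
  by rewrite leq_exp2l // /N; lia.
have K5 : (2 * K) ^ 5 <= 4 ^ N.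
  rewrite -(@leq_pmul2l 4) //; apply: (@leq_trans ((K ^ 8) ^ 2)).
    rewrite -expnM expnMn (expnD K 5 11) mulnA [leqRHS]mulnC leq_mul2r.
    by apply/orP; right; apply: (@leq_trans (4 ^ 11)) => //; apply: leq_wexp2r; lia.
  by apply: leq_trans (leq_wexp2r 2 K8) _; rewrite expnMn expnAC.
rewrite -(@leq_exp2r _ _ 5) // expnMn -!expnM ![N * 5]mulnC !expnM.
by apply: leq_trans (leq_mul K5 (leqnn _)) _; rewrite -expnMn; apply: leq_wexp2r.
Qed.

Lemma stirling3_growth t : t + 3 <= K -> 0 < t ->
  K * stirling (n - t) 3 <= stirling (n - t) 2 * stirling (n - t.+1) 2.
Proof.
move=> tK t_gt0; have nb := pow_cond_addn5_leq; have := leq_four_thirds_exp tK t_gt0.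
have -> : n - t = (n - t.+1).+1 by lia.
have [N NE] : exists N, n - t.+1 = N.+3 by exists (n - t - 4); lia.
rewrite NE !stirlingn2; have := leq_nsurj_expn N.+4 3; rewrite /nsurj.
rewrite (expnMn 2 2 N.+3) !(expnS 2 _) (expnS 3 _) (_ : 3`! = 6) //.
have := expn_gt0 2 N; move: (stirling _ _) (2 ^ N) (3 ^ N.+3) => S x y /= x_gt0 S_le y_le.
have: 6 * (K * S) <= 3 * (K * y) by rewrite ![_ * (K * _)]mulnCA leq_mul.
nia.
Qed.

Lemma stirling_ratio_growth t k : 0 < t -> t + 3 <= k <= K ->
  K * stirling (n - t) (k - t) <= stirling (n - t) 2 * stirling (n - t.+1) (k - t.+1).
Proof.
move=> t_gt0 /andP[tk kK]; have nb := pow_cond_addn5_leq.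
have growth3 := stirling3_growth (leq_trans tk kK) t_gt0.
have p_gt0 : 0 < stirling (n - t.+1) 2 by apply: stirling_gt0; lia.
rewrite -(leq_pmul2r p_gt0) -mulnA.
have ratio : stirling (n - t) (k - t) * stirling (n - t.+1) 2 <=
    stirling (n - t) 3 * stirling (n - t.+1) (k - t.+1).
  have [-> ->] : n - t = (n - t.+1).+1 /\ k - t = (k - t.+1).+1 by lia.
  by apply: leq_stirling_ratio; lia.
apply: leq_trans (leq_mul (leqnn K) ratio) _.
by rewrite mulnA [leqRHS]mulnAC; apply: leq_mul.
Qed.

End Growth.

(** * Covers and branching *)

Lemma leq_card_bigcup (T1 T2 : finType) (Y : {set T1}) (E : T1 -> {set T2}) :
  #|\bigcup_(e in Y) E e| <= \sum_(e in Y) #|E e|.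
Proof.
elim/big_rec2: _ => [|e m A _ IH]; first by rewrite cards0.
by rewrite (leq_trans (leq_card_setU _ _)) // leq_add2l.
Qed.

Lemma exists_subset_card (T : finType) (A : {set T}) m :
  m <= #|A| -> exists2 Y : {set T}, Y \subset A & #|Y| = m.
Proof.
rewrite -bin_gt0 -cards_draws => /card_gt0P[Y].
by rewrite inE => /andP[sYA /eqP cY]; exists Y.
Qed.

Lemma leq_bin_expn s x : 'C(s + x, s) <= s.+1 ^ x.
Proof.
elim: x => [|x IHx]; first by rewrite addn0 binn.
have bin_swap y : 'C(s + y, s) = 'C(s + y, y) by rewrite -bin_sub ?leq_addr // addKn.
rewrite expnS; apply: leq_trans (leq_mul (leqnn _) IHx).
rewrite -(leq_pmul2l (ltn0Sn x)) !bin_swap addnS -mul_bin_diag /= mulnA leq_mul2r.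
by apply/orP; right; nia.
Qed.

Lemma ltn_card_setI (T : finType) (A X : {set T}) : ~~ (A \subset X) -> #|A :&: X| < #|A|.
Proof.
move=> nAX; rewrite proper_card // properE subsetIl /=.
by apply: contra nAX => /subset_trans; apply; rewrite subsetIr.
Qed.

Lemma card_setD1 (T : finType) (A : {set T}) c : c \in A -> #|A :\ c| = #|A|.-1.
Proof. by move=> cA; rewrite (cardsD1 c A) cA. Qed.

Lemma setD1_subset_of_leq_card_setI (T : finType) (A G : {set T}) c :
  c \in A -> c \notin G -> #|A| <= #|A :&: G|.+1 -> A :\ c \subset G.
Proof.
move=> cA cG leAG; suff /eqP <- : A :&: G == A :\ c by rewrite subsetIr.
rewrite eqEcard card_setD1 // -subn1 leq_subLR add1n leAG andbT.
apply/subsetP => e; rewrite !inE => /andP[eA eG].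
by rewrite eA andbT; apply: contraNneq cG => <-.
Qed.

Lemma subset_of_leq_card_setI (T : finType) (A G : {set T}) : #|A| <= #|A :&: G| -> A \subset G.
Proof. by move=> leAG; apply/setIidPl/eqP; rewrite eqEcard subsetIl. Qed.

Section Branching.

Variables (B Om : finType) (GG : {set Om}) (phi : Om -> {set B}).
Implicit Types (A X T : {set B}) (g : Om).

Definition star A := [set g in GG | A \subset phi g].

Lemma starP A g : reflect (g \in GG /\ A \subset phi g) (g \in star A).
Proof. exact: setIdP. Qed.

(* If every [phi g] meets [X] in at least [s] points while [A] does not, then each [phi g]
   above [A] contains one of any [#|X|.+1 - s] points of [X :\: A]. *)
Lemma leq_card_star_step s D A X m :
    (forall g, g \in GG -> s <= #|phi g :&: X|) -> #|X| < D + s -> #|A :&: X| < s ->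
    (forall e, e \notin A -> #|star (e |: A)| <= m) ->
  #|star A| <= D * m.
Proof.
move=> sX cX AX star_le.
have [|Y sY cY] := @exists_subset_card _ (X :\: A) (#|X|.+1 - s).
  by rewrite cardsD setIC; lia.
have sYX : Y \subset X by apply: subset_trans sY (subsetDl _ _).
have star_sub : star A \subset \bigcup_(e in Y) star (e |: A).
  apply/subsetP => g; rewrite inE => /andP[gG sA].
  have [dis|] := boolP [disjoint Y & phi g].
    have : #|phi g :&: X| <= #|X :\: Y|.
      apply/subset_leq_card/subsetP => e; rewrite !inE => /andP[eg ->].
      by rewrite (disjointFl dis eg).
    have := subset_leq_card sYX; have := sX g gG.
    by rewrite cardsD (setIidPr sYX) cY; lia.
  case/pred0Pn => e /= /andP[eY eg]; apply/bigcupP; exists e => //.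
  by rewrite inE gG subUset sub1set eg sA.
apply: leq_trans (subset_leq_card star_sub) _; apply: leq_trans (leq_card_bigcup _ _) _.
apply: (@leq_trans (\sum_(e in Y) m)).
  by apply: leq_sum => e /(subsetP sY); rewrite inE => /andP[/star_le].
by rewrite sum_nat_const cY leq_mul2r; apply/orP; right; lia.
Qed.

Lemma leq_card_star_branch s D j A m :
    (forall A', A \subset A' -> #|A'| < #|A| + j ->
      exists X, [/\ forall g, g \in GG -> s <= #|phi g :&: X|, #|X| < D + s
                  & #|A' :&: X| < s]) ->
    (forall A', #|A'| = #|A| + j -> #|star A'| <= m) ->
  #|star A| <= D ^ j * m.
Proof.
elim: j A => [|j IHj] A branch star_le; first by rewrite mul1n star_le ?addn0.
have [|X [sX cX AX]] := branch A (subxx _); first by rewrite addnS ltnS leq_addr.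
rewrite expnS -mulnA; apply: leq_card_star_step sX cX AX _ => e eA.
have cE : #|A| + j.+1 = #|e |: A| + j by rewrite cardsU1 eA addnS addSn.
rewrite cE in branch star_le; apply: IHj star_le => A' sA'; apply: branch.
by apply: subset_trans sA'; rewrite subsetUr.
Qed.

Lemma leq_card_bin_star s T m :
    (forall g, g \in GG -> s <= #|T :&: phi g|) ->
    (forall A, A \subset T -> #|A| = s -> #|star A| <= m) ->
  #|GG| <= 'C(#|T|, s) * m.
Proof.
move=> sT star_le; rewrite -cards_draws; set draws := [set _ | _ & _].
have GG_sub : GG \subset \bigcup_(A in draws) star A.
  apply/subsetP => g gG; have [Y] := exists_subset_card (sT g gG).
  rewrite subsetI => /andP[sYT sYg] cY; apply/bigcupP; exists Y; rewrite inE ?gG //.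
  by rewrite sYT cY eqxx.
apply: leq_trans (subset_leq_card GG_sub) _; apply: leq_trans (leq_card_bigcup _ _) _.
rewrite -sum_nat_const; apply: leq_sum => A.
by rewrite inE => /andP[sA /eqP cA]; apply: star_le.
Qed.

End Branching.

Lemma leq_card_star_setD1 (B : finType) (GG PP : {set {set B}}) (T : {set B}) t c0 m0 m :
    GG \subset PP -> #|T| = t.+1 -> c0 \in T -> (forall G, G \in GG -> t <= #|T :&: G|) ->
    #|star PP id (T :\ c0)| <= m0 ->
    (forall c, c \in T :\ c0 -> #|star PP id (T :\ c) :\: star PP id T| <= m) ->
  #|GG| <= m0 + t * m.
Proof.
move=> sGP cT c0T sT m0_le m_le.
have GG_sub : GG \subset star PP id (T :\ c0) :|:
    \bigcup_(c in T :\ c0) (star PP id (T :\ c) :\: star PP id T).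
  apply/subsetP => G GGG; rewrite !inE (subsetP sGP _ GGG) /=.
  have [//|/subsetPn[c cT0 cG]] := boolP (T :\ c0 \subset G).
  have cinT : c \in T by move: cT0; rewrite inE => /andP[].
  apply/bigcupP; exists c => //; rewrite !inE (subsetP sGP _ GGG) /=.
  rewrite (setD1_subset_of_leq_card_setI cinT cG) ?cT ?ltnS ?sT // andbT.
  by apply/subsetPn; exists c.
apply: leq_trans (subset_leq_card GG_sub) _; apply: leq_trans (leq_card_setU _ _) _.
apply: leq_add m0_le _; apply: leq_trans (leq_card_bigcup _ _) _.
by rewrite -[t]/(t.+1.-1) -cT -(card_setD1 c0T) -sum_nat_const; apply: leq_sum.
Qed.

Section Selections.

Variables (B I : finType).
Implicit Types (F E : I -> {set {set B}}) (J S : {set I}) (A T X G H : {set B}).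
Implicit Types (f g h : {ffun I -> {set B}}).

(* The padding by [set0] outside [J] makes the number of selections exactly the product
   over [J]. *)
Definition sel F J : {set {ffun I -> {set B}}} :=
  [set f in family (fun i => if i \in J then F i else [set set0])].

Definition inter J f : {set B} := \bigcap_(i in J) f i.

Definition cross F J s := [forall f in sel F J, s <= #|inter J f|].

Definition covers F J s T := [forall f in sel F J, s <= #|T :&: inter J f|].

Lemma selP F J f :
  reflect ((forall i, i \in J -> f i \in F i) /\ (forall i, i \notin J -> f i = set0))
          (f \in sel F J).
Proof.
rewrite inE; apply: (iffP familyP) => [fF|[fF f0] i].
  by split=> i iJ; have := fF i; rewrite ?iJ ?(negbTE iJ) // inE => /eqP.
by case: ifPn => [/fF|/f0->] //; rewrite inE.
Qed.

Lemma card_sel F J : #|sel F J| = \prod_(i in J) #|F i|.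
Proof.
rewrite cardsE card_family foldrE big_map big_enum /= [RHS]big_mkcond /=.
by apply: eq_bigr => i _; case: ifP => // _; rewrite cards1.
Qed.

Lemma star_sel F J A :
  star (sel F J) (inter J) A = sel (fun i => star (F i) id A) J.
Proof.
apply/setP => f; rewrite inE; apply/andP/selP => [[/selP[fF f0] /bigcapsP sA]|[fF f0]].
  by split=> // i iJ; rewrite inE fF ?sA.
split; first by apply/selP; split=> // i /fF; rewrite inE => /andP[].
by apply/bigcapsP => i /fF; rewrite inE => /andP[].
Qed.

Definition single i G : {ffun I -> {set B}} := [ffun j => if j == i then G else set0].

Lemma inter1 i f : inter [set i] f = f i. Proof. exact: big_set1. Qed.

Lemma inter_single i G : inter [set i] (single i G) = G.
Proof. by rewrite inter1 ffunE eqxx. Qed.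

Lemma sel1P F i f : reflect (exists2 G, G \in F i & f = single i G) (f \in sel F [set i]).
Proof.
apply: (iffP (selP _ _ _)) => [[fF f0]|[G GF ->]].
  exists (f i); first by rewrite fF ?set11.
  apply/ffunP => j; rewrite ffunE; case: eqP => [->//|/eqP ji].
  by apply: f0; rewrite inE.
by split=> j; rewrite inE ffunE; case: eqP => // ->.
Qed.

Lemma single_sel F i G : G \in F i -> single i G \in sel F [set i].
Proof. by move=> GF; apply/sel1P; exists G. Qed.

Lemma sel_setU F J1 J2 f g : [disjoint J1 & J2] -> f \in sel F J1 -> g \in sel F J2 ->
  exists2 h, h \in sel F (J1 :|: J2) & inter (J1 :|: J2) h = inter J1 f :&: inter J2 g.
Proof.
move=> dis /selP[fF f0] /selP[gF g0]; pose h := [ffun i => if i \in J1 then f i else g i].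
have hf i : i \in J1 -> h i = f i by move=> iJ; rewrite ffunE iJ.
have hg i : i \in J2 -> h i = g i by move=> iJ; rewrite ffunE (disjointFl dis iJ).
exists h.
  apply/selP; split=> i; rewrite inE.
    by case/orP => iJ; rewrite ?(hf _ iJ) ?(hg _ iJ); auto.
  by rewrite negb_or ffunE => /andP[/negbTE-> /g0].
rewrite /inter bigcap_setU.
by congr (_ :&: _); apply: eq_bigr => i iJ; rewrite ?(hf _ iJ) ?(hg _ iJ).
Qed.

Lemma crossE F J s : cross F J s = covers F J s setT.
Proof. by apply: eq_forallb => f; rewrite setTI. Qed.

Lemma covers_setU F J1 J2 s T f g : [disjoint J1 & J2] -> covers F (J1 :|: J2) s T ->
    f \in sel F J1 -> g \in sel F J2 ->
  s <= #|T :&: (inter J1 f :&: inter J2 g)|.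
Proof.
move=> dis /forall_inP covT fs gs.
by have [h hs <-] := sel_setU dis fs gs; apply: covT.
Qed.

Lemma cross_setU F J1 J2 s f g : [disjoint J1 & J2] -> cross F (J1 :|: J2) s ->
  f \in sel F J1 -> g \in sel F J2 -> s <= #|inter J1 f :&: inter J2 g|.
Proof. by rewrite crossE -[inter J1 f]setTI -setIA; apply: covers_setU. Qed.

Lemma cross_setU1 F J i s G f : i \notin J -> cross F (i |: J) s ->
  G \in F i -> f \in sel F J -> s <= #|G :&: inter J f|.
Proof.
move=> iJ cr GF fs; rewrite -(inter_single i G).
by apply: cross_setU fs => //; rewrite ?disjoints1 // single_sel.
Qed.

Lemma covers1P F i s T :
  reflect (forall G, G \in F i -> s <= #|T :&: G|) (covers F [set i] s T).
Proof.
apply: (iffP forall_inP) => [covT G GF|covT f /sel1P[G GF ->]].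
  by rewrite -(inter_single i G) covT ?single_sel.
by rewrite inter_single covT.
Qed.

Lemma prod_card_star_full F J A : (forall i G, i \in J -> G \in F i -> A \subset G) ->
  \prod_(i in J) #|F i| = #|star (sel F J) (inter J) A|.
Proof.
move=> sA; rewrite -card_sel; apply: eq_card => f; rewrite [RHS]inE.
case: (boolP (f \in _)) => // /selP[fF _]; symmetry; apply/bigcapsP => i iJ.
exact: sA iJ (fF i iJ).
Qed.

Definition cover_num F J s := #|[arg min_(T < [set: B] | covers F J s T) #|T| ]|.

Definition excess F J s := cover_num F J s - s.

Section Nonempty.

Variable F : I -> {set {set B}}.
Hypothesis F_ne : forall i, F i != set0.

Lemma exists_sel J : exists f, f \in sel F J.
Proof.
by apply/card_gt0P; rewrite card_sel prodn_cond_gt0 // => i _; rewrite card_gt0.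
Qed.

Lemma sel_extend S J h : S \subset J -> h \in sel F S ->
  exists2 f, f \in sel F J & inter J f \subset inter S h.
Proof.
move=> sSJ hs; have [g gs] := exists_sel (J :\: S).
have [f fs fE] := sel_setU (disjoint_setDr S J) hs gs; exists f.
  by rewrite -{1}(setIidPr sSJ) setID in fs.
by rewrite -{1}(setIidPr sSJ) setID in fE; rewrite fE subsetIl.
Qed.

Lemma covers_sub S J s T : S \subset J -> covers F J s T -> covers F S s T.
Proof.
move=> sSJ /forall_inP covT; apply/forall_inP => h /(sel_extend sSJ)[f fs sub].
by apply: leq_trans (covT f fs) _; rewrite subset_leq_card ?setIS.
Qed.

Lemma cross_sub S J s : S \subset J -> cross F J s -> cross F S s.
Proof. by rewrite !crossE; apply: covers_sub. Qed.

Lemma covers_pair J s T i j G H : covers F J s T -> i \in J -> j \in J -> i != j ->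
  G \in F i -> H \in F j -> s <= #|T :&: (G :&: H)|.
Proof.
move=> covT iJ jJ ij GF HF; rewrite -(inter_single i G) -(inter_single j H).
apply: covers_setU (single_sel GF) (single_sel HF); first by rewrite disjoints1 inE.
by apply: covers_sub covT; rewrite subUset !sub1set iJ.
Qed.

Lemma cross_pair J s i j G H : cross F J s -> i \in J -> j \in J -> i != j ->
  G \in F i -> H \in F j -> s <= #|G :&: H|.
Proof. by rewrite crossE -[G :&: H]setTI; apply: covers_pair. Qed.

Lemma cross_triple s i j l G H P : cross F [set: I] s ->
    [/\ i != j, j != l & l != i] -> [/\ G \in F i, H \in F j & P \in F l] ->
  s <= #|G :&: H :&: P|.
Proof.
move=> cr [ij jl li] [GF HF PF].
have dis : [disjoint [set i] & [set j]] by rewrite disjoints1 inE.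
have [h hs] := sel_setU dis (single_sel GF) (single_sel HF).
rewrite !inter_single => <-; rewrite -(inter_single l P).
apply: cross_setU (single_sel PF) => //; last by apply: cross_sub (subsetT _) cr.
by rewrite disjoint_sym disjoints1 !inE negb_or li eq_sym jl.
Qed.

Lemma covers_inter J1 J2 s f : [disjoint J1 & J2] -> cross F (J1 :|: J2) s ->
  f \in sel F J1 -> covers F J2 s (inter J1 f).
Proof. by move=> dis cr fs; apply/forall_inP => g; apply: cross_setU fs. Qed.

Lemma leq_covers J s T : covers F J s T -> s <= #|T|.
Proof.
move=> /forall_inP covT; have [f fs] := exists_sel J.
by apply: leq_trans (covT f fs) _; rewrite subset_leq_card ?subsetIl.
Qed.

Lemma cover_num_covers J s : cross F J s ->
  exists2 T, covers F J s T & #|T| = cover_num F J s.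
Proof. by rewrite crossE /cover_num => covT; case: arg_minnP => // T; exists T. Qed.

Lemma cover_num_min J s T : covers F J s T -> cover_num F J s <= #|T|.
Proof.
move=> covT; rewrite /cover_num; case: arg_minnP => [|T' _]; last exact.
rewrite -crossE; apply/forall_inP => f fs; apply: leq_trans (forall_inP covT f fs) _.
by rewrite subset_leq_card ?subsetIr.
Qed.

Lemma cover_numE J s : cross F J s -> cover_num F J s = s + excess F J s.
Proof. by rewrite /excess => /cover_num_covers[T /leq_covers s_le <-]; rewrite subnKC. Qed.

(* Choose [s] points in a minimum cover of [J1], then branch along members of [J2] missed so
   far, as long as there are fewer points than in a minimum cover of [J2]. *)
Lemma leq_prod_branch K J1 J2 s D j m : s < K ->
    [disjoint J1 & J2] -> cross F (J1 :|: J2) s ->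
    (forall g, g \in sel F J2 -> #|inter J2 g| < D + s) -> j <= excess F J2 s ->
    (forall A, #|A| = s + j -> \prod_(i in J1) #|star (F i) id A| <= m) ->
  \prod_(i in J1) #|F i| <= K ^ excess F J1 s * (D ^ j * m).
Proof.
move=> sK dis cr D_bound j_le star_le.
have cr1 : cross F J1 s by apply: cross_sub cr; apply: subsetUl.
have cr2 : cross F J2 s by apply: cross_sub cr; apply: subsetUr.
have [T covT cT] := cover_num_covers cr1.
apply: (@leq_trans ('C(#|T|, s) * (D ^ j * m))); last first.
  rewrite leq_mul // cT cover_numE //; apply: leq_trans (leq_bin_expn _ _) _.
  exact: leq_wexp2r.
rewrite -card_sel; apply: (leq_card_bin_star (phi := inter J1)).
  exact/forall_inP.
move=> A _ cA; apply: (leq_card_star_branch (s := s)) => [A' _ cA'|A' cA']; last first.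
  by rewrite star_sel card_sel star_le ?cA' ?cA.
have: ~~ covers F J2 s A'.
  by apply/negP => /cover_num_min; rewrite cover_numE //; lia.
rewrite negb_forall_in => /exists_inP[g gs]; rewrite -ltnNge => lt_s.
exists (inter J2 g); split=> //; last exact: D_bound.
by move=> f fs; apply: cross_setU fs gs.
Qed.

Lemma leq_prod_balance K J1 J2 s m1 m2 : s < K ->
    [disjoint J1 & J2] -> cross F (J1 :|: J2) s ->
    (forall f, f \in sel F J1 -> #|inter J1 f| < K + s) ->
    (forall f, f \in sel F J2 -> #|inter J2 f| < K + s) ->
    (forall A, #|A| = s + excess F J2 s ->
      (K ^ 2) ^ excess F J2 s * \prod_(i in J1) #|star (F i) id A| <= m1) ->
    (forall A, #|A| = s + excess F J1 s ->
      (K ^ 2) ^ excess F J1 s * \prod_(i in J2) #|star (F i) id A| <= m2) ->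
  \prod_(i in J1) #|F i| * \prod_(i in J2) #|F i| <= m1 * m2.
Proof.
move=> sK dis cr inter1_lt inter2_lt star1_le star2_le.
set x := excess F J1 s; set z := excess F J2 s.
have K_gt0 e : 0 < (K ^ 2) ^ e by rewrite !expn_gt0; lia.
have dis' : [disjoint J2 & J1] by rewrite disjoint_sym.
have cr' : cross F (J2 :|: J1) s by rewrite setUC.
have prod1_le : \prod_(i in J1) #|F i| <= K ^ x * (K ^ z * (m1 %/ (K ^ 2) ^ z)).
  apply: leq_prod_branch (leqnn _) _ => // A cA.
  by rewrite leq_divRL // mulnC star1_le.
have prod2_le : \prod_(i in J2) #|F i| <= K ^ z * (K ^ x * (m2 %/ (K ^ 2) ^ x)).
  apply: leq_prod_branch (leqnn _) _ => // A cA.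
  by rewrite leq_divRL // mulnC star2_le.
apply: leq_trans (leq_mul prod1_le prod2_le) _.
have -> : K ^ x * (K ^ z * (m1 %/ (K ^ 2) ^ z)) * (K ^ z * (K ^ x * (m2 %/ (K ^ 2) ^ x))) =
    m1 %/ (K ^ 2) ^ z * (K ^ 2) ^ z * (m2 %/ (K ^ 2) ^ x * (K ^ 2) ^ x).
  by rewrite -!expnM (mulnC 2 z) (mulnC 2 x) !expnM -!mulnn; lia.
by rewrite leq_mul // leq_trunc_div.
Qed.

End Nonempty.
End Selections.

(** * Partitions containing or meeting given blocks *)

Lemma card_partition_leq (T : finType) (A : {set {set T}}) (D : {set T}) :
  partition A D -> #|A| <= #|D|.
Proof.
move=> pA; rewrite (card_partition pA) -sum1_card; apply: leq_sum => B BA.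
by rewrite card_gt0 (partition_neq0 pA BA).
Qed.

Lemma card_partition_ltn (T : finType) (A : {set {set T}}) (D c : {set T}) :
  partition A D -> c \in A -> #|c| != 1 -> #|A| < #|D|.
Proof.
move=> pA cA c_1; rewrite (cardsD1 c) cA (card_partition pA) (big_setD1 c cA) /=.
have c_gt1 : 1 < #|c|.
  by rewrite ltn_neqAle eq_sym c_1 card_gt0 (partition_neq0 pA cA).
rewrite -addSn leq_add // -sum1_card; apply: leq_sum => B; rewrite inE => /andP[_ BA].
by rewrite card_gt0 (partition_neq0 pA BA).
Qed.

Section StarCount.

Variable n : nat.
Implicit Types (k m s t : nat) (P Q A T : {set {set 'I_n}}).

Lemma PiP k P : reflect (partition P [set: 'I_n] /\ #|P| = k) (P \in Pi n k).
Proof. exact: kpartitionsP. Qed.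

Lemma card_star_partition k A : partition A (cover A) -> #|A| <= k ->
  #|star (Pi n k) id A| = stirling (n - #|cover A|) (k - #|A|).
Proof.
move=> pA cA; rewrite /star -[Pi n k]/(kpartitions _ k) card_kpartitions_above ?subsetT //.
by rewrite card_kpartitions setTD cardsCs setCK card_ord.
Qed.

Lemma leq_card_star m k A : #|A| < k -> (partition A (cover A) -> m <= #|cover A|) ->
  #|star (Pi n k) id A| <= stirling (n - m) (k - #|A|).
Proof.
move=> cA m_le; have [->|/set0Pn[P]] := eqVneq (star (Pi n k) id A) set0.
  by rewrite cards0.
case/starP => /PiP[pP _] /(partition_sub pP) pA.
by rewrite card_star_partition ?(ltnW cA) // leq_stirlingl ?subn_gt0 // leq_sub2l ?m_le.
Qed.

Lemma leq_card_star_card k A : #|A| < k ->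
  #|star (Pi n k) id A| <= stirling (n - #|A|) (k - #|A|).
Proof. by move=> cA; apply: leq_card_star => // /card_partition_leq. Qed.

Lemma card_star_le1 k A : k <= #|A|.+1 -> #|star (Pi n k) id A| <= 1.
Proof.
rewrite leq_eqVlt ltnS => /predU1P[kE|kA].
  apply: leq_trans (leq_card_star_card _) _; rewrite kE // subSnn.
  exact: leq_stirlingn1.
apply/card_le1_eqP => P Q /starP[/PiP[_ cP] sP] /starP[/PiP[_ cQ] sQ].
have eqA (R : {set {set 'I_n}}) : #|R| = k -> A \subset R -> R = A.
  by move=> cR sR; apply/eqP; rewrite eq_sym eqEcard sR cR.
by rewrite (eqA P cP sP) (eqA Q cQ sQ).
Qed.

Lemma star_eq0 k A : k < #|A| -> star (Pi n k) id A = set0.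
Proof.
move=> kA; apply/eqP; rewrite -subset0; apply/subsetP => P /starP[/PiP[_ cP]].
by move/subset_leq_card; rewrite cP leqNgt kA.
Qed.

Lemma card_star_decay K s k A : 3 <= K -> pow_cond n K ->
    0 < s -> s + 2 <= k <= K -> s <= #|A| ->
  (2 * K ^ 2) ^ (#|A| - s) * #|star (Pi n k) id A| <= stirling (n - s) (k - s).
Proof.
move=> K_ge3 nK s_gt0 skK sA; have [kA|Ak] := ltnP k #|A|.
  by rewrite star_eq0 // cards0 muln0.
have [Ak2|kA] := leqP (#|A| + 2) k.
  apply: leq_trans (leq_mul (leqnn _) (leq_card_star_card _)) _; first by lia.
  by have := @stirling_decay n K K_ge3 nK k s (#|A| - s) s_gt0; rewrite subnKC //; apply; lia.
apply: leq_trans (leq_mul (leqnn _) (card_star_le1 _)) _; first by lia.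
by rewrite muln1 leq_exp_stirling // subnKC.
Qed.

Lemma card_star_singletons k A : (forall B, B \in A -> #|B| = 1) -> #|A| <= k ->
  #|star (Pi n k) id A| = stirling (n - #|A|) (k - #|A|).
Proof.
move=> A1 cA; have pA : partition A (cover A).
  rewrite /partition eqxx /=; apply/andP; split; last by apply/negP => /A1; rewrite cards0.
  apply/trivIsetP => B C BA CA.
  have /eqP/cards1P[x ->] := A1 B BA; have /eqP/cards1P[y ->] := A1 C CA => ne.
  by rewrite disjoints1 inE; apply: contraNneq ne => ->.
rewrite card_star_partition // (card_partition pA).
by rewrite -[X in _ = stirling (n - X) _]sum1_card (eq_bigr (fun=> 1)).
Qed.

Lemma card_star_block k k' P A : P \in Pi n k' -> A \subset P -> #|A| <= k ->
  #|star (Pi n k) id A| = stirling (\sum_(B in P :\: A) #|B|) (k - #|A|).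
Proof.
case/PiP => pP _ sA cA; rewrite card_star_partition ?(partition_sub pP) //.
by rewrite -(card_partition (partitionD pP sA)) setTD [#|~: _|]cardsCs setCK card_ord.
Qed.

Definition meeting t k T := [set P in Pi n k | t <= #|T :&: P|].

Lemma meetingP t k T P : reflect (P \in Pi n k /\ t <= #|T :&: P|) (P \in meeting t k T).
Proof. exact: setIdP. Qed.

Lemma leq_card_meetingS t k P : t + 2 <= k -> t + 2 <= n -> P \in Pi n (t + 2) ->
  #|meeting t.+1 k P| <= stirling (n - t.+1) (k - t.+1).
Proof.
move=> tk tn Pp; have [pP cP] := PiP _ _ Pp.
have cPD c : c \in P -> #|P :\ c| = t.+1 by move=> cP'; rewrite card_setD1 // cP addn2.
have near_sub : meeting t.+1 k P \subset \bigcup_(c in P) star (Pi n k) id (P :\ c).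
  apply/subsetP => G /meetingP[Gp tG].
  suff [c cP' sG] : exists2 c, c \in P & P :\ c \subset G.
    by apply/bigcupP; exists c; rewrite // inE Gp.
  have [sPG|/subsetPn[c cP' cG]] := boolP (P \subset G).
    have /card_gt0P[c cP'] : 0 < #|P| by rewrite cP addn2.
    by exists c => //; apply: subset_trans (subsetDl _ _) sPG.
  by exists c => //; apply: setD1_subset_of_leq_card_setI; rewrite // cP addn2.
move: tk; rewrite leq_eqVlt => /predU1P[kE|tk].
  have -> : k - t.+1 = 1 by lia.
  have -> : n - t.+1 = (n - t - 2).+1 by lia.
  rewrite stirlingn1 -(cards1 P); apply/subset_leq_card/subsetP => G Gn; rewrite inE; apply/eqP.
  have /bigcupP[c cP' Gc] := subsetP near_sub G Gn.
  have /card_le1_eqP : #|star (Pi n k) id (P :\ c)| <= 1 by apply: card_star_le1; rewrite cPD; lia.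
  by apply=> //; rewrite inE -kE Pp subsetDl.
apply: leq_trans (subset_leq_card near_sub) _; apply: leq_trans (leq_card_bigcup _ _) _.
apply: (@leq_trans (\sum_(c in P) stirling #|c| (k - t.+1))).
  apply: leq_sum => c cP'; rewrite (card_star_block Pp) ?subsetDl ?cPD //; last by lia.
  by rewrite setDDr setDv set0U (setIidPr _) ?sub1set // big_set1.
apply: leq_trans (leq_sum_stirling _ _) _; first by lia.
  by move=> c cP'; rewrite card_gt0 (partition_neq0 pP cP').
by rewrite -(card_partition pP) cardsT card_ord cP leq_stirlingl; lia.
Qed.

End StarCount.

Definition extremal_card n t k :=
  t.+1 * stirling (n - t) (k - t) - t * stirling (n - t.+1) (k - t.+1).

Lemma leq_stirling_sub n k t : t < n -> t < k ->
  stirling (n - t.+1) (k - t.+1) <= stirling (n - t) (k - t).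
Proof.
by move=> tn tk; rewrite -(subnSK tn) -(subnSK tk) leq_stirlingS.
Qed.

Lemma extremal_cardE n k t : t < n -> t < k ->
  extremal_card n t k = stirling (n - t) (k - t) +
    t * (stirling (n - t) (k - t) - stirling (n - t.+1) (k - t.+1)).
Proof.
move=> tn tk; rewrite /extremal_card mulSn mulnBr addnBA // leq_mul2l.
by rewrite leq_stirling_sub ?orbT.
Qed.

Lemma leq_extremal_ratio n t i j : t < n -> t < i <= j ->
  extremal_card n t j * stirling (n - t.+1) (i - t.+1) <=
    extremal_card n t i * stirling (n - t.+1) (j - t.+1).
Proof.
move=> tn /andP[ti ij]; rewrite !mulnBl -!mulnA [X in _ <= _ - _ * X]mulnC leq_sub2r //.
rewrite leq_mul2l /= -(subnSK tn) -(subnSK ti) -(subnSK (leq_trans ti ij)).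
by apply: leq_stirling_ratio; apply: leq_sub2r.
Qed.

Lemma ltn_extremal_ratio n t i j : t < i < j -> j <= n ->
  extremal_card n t j * stirling (n - t.+1) (i - t.+1) <
    extremal_card n t i * stirling (n - t.+1) (j - t.+1).
Proof.
move=> /andP[ti ij] jn; have tj := ltn_trans ti ij; have tn := leq_trans tj jn.
have ratio : stirling (n - t) (j - t) * stirling (n - t.+1) (i - t.+1) <
    stirling (n - t) (i - t) * stirling (n - t.+1) (j - t.+1).
  rewrite -(subnSK tn) -(subnSK ti) -(subnSK tj).
  by apply: ltn_stirling_ratio; lia.
have ratioS : t.+1 * (stirling (n - t) (j - t) * stirling (n - t.+1) (i - t.+1)) <
    t.+1 * (stirling (n - t) (i - t) * stirling (n - t.+1) (j - t.+1)).
  by rewrite ltn_pmul2l.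
rewrite !mulnBl -!mulnA [X in _ < _ - _ * X]mulnC ltn_sub2r //.
apply: leq_ltn_trans ratioS; apply: leq_mul; first exact: leqnSn.
by rewrite leq_mul2r leq_stirling_sub ?orbT.
Qed.

Section Meeting.

Variable n : nat.
Implicit Types (k t : nat) (P H A T : {set {set 'I_n}}).

Lemma meeting_sub t k T : meeting t k T \subset Pi n k.
Proof. by apply/subsetP => P /meetingP[]. Qed.

Lemma leq_card_meeting_singletons t k T : #|T| = t.+1 -> (forall B, B \in T -> #|B| = 1) ->
  t + 2 <= k <= n -> #|meeting t k T| <= extremal_card n t k.
Proof.
move=> cT T1 tk; have /card_gt0P[c0 c0T] : 0 < #|T| by rewrite cT.
have cTD c : c \in T -> #|star (Pi n k) id (T :\ c)| = stirling (n - t) (k - t).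
  move=> cinT; rewrite card_star_singletons ?card_setD1 ?cT //=; last by lia.
  by move=> B; rewrite inE => /andP[_ /T1].
rewrite extremal_cardE; [|lia..].
apply: (leq_card_star_setD1 (meeting_sub t k T) cT c0T).
- by move=> G /meetingP[].
- by rewrite cTD.
- move=> c; rewrite inE => /andP[_ cinT]; rewrite cardsD (setIidPr _).
    by rewrite cTD // [#|star _ _ T|]card_star_singletons // cT; lia.
  by apply/subsetP => P /starP[PP sTP]; rewrite inE PP (subset_trans (subsetDl _ _)).
Qed.

Lemma leq_card_meeting_nonsingleton t k T c0 : #|T| = t.+1 -> c0 \in T -> #|c0| != 1 ->
    t + 2 <= k ->
  #|meeting t k T| <= stirling (n - t) (k - t) + t * stirling (n - t.+1) (k - t).
Proof.
move=> cT c0T c0_1 tk; have cTD c : c \in T -> #|T :\ c| = t.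
  by move=> cinT; rewrite card_setD1 // cT.
apply: (leq_card_star_setD1 (meeting_sub t k T) cT c0T).
- by move=> G /meetingP[].
- by apply: leq_trans (leq_card_star_card _) _; rewrite cTD //; lia.
- move=> c; rewrite !inE => /andP[c_c0 cinT].
  apply: leq_trans (subset_leq_card (subsetDl _ _)) _; rewrite -{2}(cTD c cinT).
  apply: leq_card_star; first by rewrite cTD //; lia.
  rewrite -(cTD c cinT); move/card_partition_ltn; apply; last exact: c0_1.
  by rewrite !inE eq_sym c_c0.
Qed.

Lemma card_meeting_nonsingleton_lt t k T c0 : 0 < t -> #|T| = t.+1 -> c0 \in T ->
  #|c0| != 1 -> t + 2 <= k < n -> #|meeting t k T| < extremal_card n t k.
Proof.
move=> t_gt0 cT c0T c0_1 /andP[tk kn].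
apply: leq_ltn_trans (leq_card_meeting_nonsingleton cT c0T c0_1 tk) _.
rewrite extremal_cardE ?ltn_add2l ?ltn_pmul2l //; [|lia..].
have [-> ->] : n - t = (n - t.+1).+1 /\ k - t = (k - t.+2).+2 by lia.
rewrite stirlingS [k - t.+1](_ : _ = (k - t.+2).+1); last by lia.
by have := @stirling_gt0 (n - t.+1) (k - t.+2).+2; nia.
Qed.

End Meeting.

Section Pairs.

Variables (T : finType) (P : {set T}) (a : T -> nat).
Implicit Types (A : {set T}) (u w : T).

Definition pairs : {set {set T}} := [set A : {set T} | A \subset P & #|A| == 2].

Lemma pairsP A :
  reflect (exists u w, [/\ u != w, u \in P, w \in P & A = [set u; w]]) (A \in pairs).
Proof.
rewrite inE; apply: (iffP andP) => [[sA /cards2P[u [w [uw AE]]]]|[u [w [uw uP wP ->]]]].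
  by exists u, w; move: sA; rewrite AE subUset !sub1set => /andP[].
by rewrite subUset !sub1set uP wP cards2 uw.
Qed.

Lemma card_pairs_mem u : u \in P -> #|[set A in pairs | u \in A]| = #|P|.-1.
Proof.
move=> uP; rewrite -(card_setD1 uP).
have pair_inj : {in P :\ u &, injective (fun w => [set u; w])}.
  move=> w w'; rewrite !inE => /andP[wu _] _ /setP/(_ w).
  by rewrite !inE eqxx orbT (negbTE wu) => /esym/eqP.
rewrite -(card_in_imset pair_inj); apply: eq_card => A.
apply/setIdP/imsetP => [[/pairsP[v [w [vw vP wP ->]]]]|[w]].
  rewrite !inE => /orP[/eqP ->|/eqP ->]; last first.
    by exists v; rewrite ?inE 1?vw 1?setUC.
  by exists w; rewrite ?inE // eq_sym vw.
case/setD1P => wu wP ->; rewrite set21; split=> //.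
by apply/pairsP; exists u, w; rewrite eq_sym.
Qed.

Lemma prod_add1_sum_subsets :
  \prod_(u in P) (1 + a u) = \sum_(A : {set T} | A \subset P) \prod_(u in A) a u.
Proof.
rewrite big_mkcond /= (eq_bigr (fun u => (if u \in P then a u else 0) + 1)); last first.
  by move=> u _; case: ifP; rewrite // addnC.
rewrite bigA_distr [RHS]big_mkcond; apply: eq_bigr => A _.
rewrite -big_mkcond /=; case: ifPn => [sAP|/subsetPn[u uA uP]].
  by apply: eq_bigr => u /(subsetP sAP) ->.
by rewrite (bigD1 u) //= (negbTE uP).
Qed.

Lemma leq_sum_pairs_prod_add1 :
  1 + \sum_(u in P) a u + \sum_(A in pairs) \prod_(u in A) a u <= \prod_(u in P) (1 + a u).
Proof.
rewrite prod_add1_sum_subsets [leqRHS](bigID (mem pairs)) /= [leqRHS]addnC leq_add //; last first.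
  by apply/eq_leq/eq_bigl => A; rewrite inE; case: (A \subset P).
rewrite (bigD1 set0) /= ?sub0set ?inE ?cards0 ?andbF // big_set0 leq_add2l.
have set1_imset : \sum_(u in P) a u = \sum_(A in [set [set u] | u in P]) \prod_(u in A) a u.
  by rewrite big_imset /= => [|u w _ _ /set1_inj //]; apply: eq_bigr => u _; rewrite big_set1.
rewrite set1_imset [leqRHS](bigID (mem [set [set u] | u in P])) /=.
apply: leq_trans (leq_addr _ _); apply/eq_leq/eq_bigl => A.
case: imsetP => [[u uP ->]|//]; rewrite ?andbF //=.
by rewrite sub1set uP inE cards1 andbF -cards_eq0 cards1.
Qed.

Lemma sum_pairs_sum :
  \sum_(A in pairs) \sum_(u in A) a u = #|P|.-1 * \sum_(u in P) a u.
Proof.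
rewrite (exchange_big_dep (mem P)) /=; last first.
  by move=> A u; rewrite inE => /andP[/subsetP sAP _] /sAP.
rewrite big_distrr; apply: eq_bigr => u uP; rewrite sum_nat_const -(card_pairs_mem uP).
by congr (_ * _); apply: eq_card => A; rewrite [RHS]in_set.
Qed.

Lemma sum_pairs_prod_add1 : \sum_(A in pairs) (\prod_(u in A) (1 + a u) - 1) =
  #|P|.-1 * \sum_(u in P) a u + \sum_(A in pairs) \prod_(u in A) a u.
Proof.
rewrite -sum_pairs_sum -big_split; apply: eq_bigr => A /pairsP[u [w [uw _ _ ->]]] /=.
by rewrite !big_setU1 ?inE ?uw //= !big_set1; nia.
Qed.

(* A partition sharing all but two blocks with [P] redistributes the union of a pair of blocks,
   so partitions meeting [P] in all but two blocks are counted by a sum over pairs of blocks of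
   [2 ^ (#|u| + #|w| - 1)]. With [1 + a u = 2 ^ (#|u| - 1)], this inequality says that the
   sum is largest, for a given total size, when all blocks but one are singletons. *)
Lemma leq_sum_pairs_prod : 2 <= #|P| ->
  \sum_(A in pairs) (\prod_(u in A) (1 + a u) - 1) +
    #|P|.-2 * \sum_(A in pairs) \prod_(u in A) a u
  <= #|P|.-1 * (\prod_(u in P) (1 + a u) - 1).
Proof.
move=> P_ge2; rewrite sum_pairs_prod_add1 -addnA -mulSn prednK; last by lia.
rewrite -mulnDr leq_mul2l; apply/orP; right.
by have := leq_sum_pairs_prod_add1; lia.
Qed.

End Pairs.

Section NearPartition.

Variables (n k : nat) (P : {set {set 'I_n}}).
Implicit Types (t : nat) (A H : {set {set 'I_n}}) (B u w : {set 'I_n}).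
Hypothesis Pp : P \in Pi n k.

Lemma prod_expn_blocks : \prod_(B in P) 2 ^ #|B|.-1 = 2 ^ (n - k).
Proof.
have [pP cP] := PiP _ _ Pp; rewrite -expn_sum; congr (2 ^ _).
have := card_partition pP; rewrite cardsT card_ord => nE.
suff : k + \sum_(B in P) #|B|.-1 = \sum_(B in P) #|B| by lia.
rewrite -cP -sum1_card -big_split; apply: eq_bigr => B BP /=.
by rewrite add1n prednK // card_gt0 (partition_neq0 pP BP).
Qed.

Lemma card_star_pair A : A \in pairs P ->
  #|star (Pi n k) id (P :\: A)| = 1 + 2 * (\prod_(B in A) 2 ^ #|B|.-1 - 1).
Proof.
case/pairsP => u [w [uw uP wP ->]]; have [pP cP] := PiP _ _ Pp.
have sub : [set u; w] \subset P by rewrite subUset !sub1set uP.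
have cPD : #|P :\: [set u; w]| = k - 2 by rewrite cardsD (setIidPr sub) cards2 uw cP.
have k_ge2 : 2 <= k by rewrite -cP (leq_trans _ (subset_leq_card sub)) // cards2 uw.
rewrite (card_star_block Pp) ?subsetDl ?cPD ?leq_subr //.
rewrite setDDr setDv set0U (setIidPr sub) subKn //.
rewrite !big_setU1 ?inE ?uw //= !big_set1 -expnD.
have u_gt0 : 0 < #|u| by rewrite card_gt0 (partition_neq0 pP uP).
have w_gt0 : 0 < #|w| by rewrite card_gt0 (partition_neq0 pP wP).
have -> : #|u| + #|w| = (#|u|.-1 + #|w|.-1).+2 by lia.
rewrite stirlingn2 expnS.
have : 0 < 2 ^ (#|u|.-1 + #|w|.-1) by rewrite expn_gt0.
by move: (2 ^ _) => x; lia.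
Qed.

Lemma meeting_pair t H : k = t + 2 -> H \in meeting t k P ->
  exists2 A, A \in pairs P & P :\: A \subset H.
Proof.
move=> kE /meetingP[_ /exists_subset_card[Y]]; rewrite subsetI => /andP[sYP sYH] cY.
exists (P :\: Y); last by rewrite setDDr setDv set0U (setIidPr sYP).
by rewrite inE subsetDl cardsD (setIidPr sYP) cY; have [_ ->] := PiP _ _ Pp; apply/eqP; lia.
Qed.

Lemma leq_card_meeting_pairs t : k = t + 2 ->
  #|meeting t k P| <= 1 + 2 * \sum_(A in pairs P) (\prod_(B in A) 2 ^ #|B|.-1 - 1).
Proof.
move=> kE.
have meet_sub : meeting t k P \subset
    P |: \bigcup_(A in pairs P) (star (Pi n k) id (P :\: A) :\ P).
  apply/subsetP => H Hm; rewrite inE in_set1; have [//|HP /=] := eqVneq H P.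
  have [A Ap sH] := meeting_pair kE Hm; have [Hp _] := meetingP _ _ _ _ Hm.
  by apply/bigcupP; exists A => //; rewrite in_setD1 HP; apply/starP.
apply: leq_trans (subset_leq_card meet_sub) _; rewrite cardsU1.
apply: leq_add; first exact: leq_b1.
apply: leq_trans (leq_card_bigcup _ _) _; rewrite big_distrr leq_sum //= => A Ap.
rewrite card_setD1 ?card_star_pair //.
by apply/starP; rewrite subsetDl.
Qed.

End NearPartition.

Lemma extremal_card_add2 n t : t + 2 <= n ->
  extremal_card n t (t + 2) = 1 + 2 * (t.+1 * (2 ^ (n - (t + 2)) - 1)).
Proof.
move=> tn; have [e ->] : exists e, n = t + 2 + e by exists (n - (t + 2)); lia.
rewrite /extremal_card !addKn (_ : t + 2 + e - t = e.+2); last by lia.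
rewrite (_ : t + 2 + e - t.+1 = e.+1); last by lia.
rewrite (_ : t + 2 - t.+1 = 1); last by lia.
rewrite stirlingn1 stirlingn2 expnS.
have : 0 < 2 ^ e by rewrite expn_gt0.
by move: (2 ^ e) => [//|x] _; rewrite !subn1 /=; lia.
Qed.

Section NearSmallPartition.

Variables (n t : nat) (P : {set {set 'I_n}}).
Hypothesis t_gt0 : 0 < t.
Hypothesis tn : t + 2 <= n.
Hypothesis Pp : P \in Pi n (t + 2).

Lemma card_meeting_two_nonsingletons_lt u w :
    u \in P -> w \in P -> u != w -> #|u| != 1 -> #|w| != 1 ->
  #|meeting t (t + 2) P| < extremal_card n t (t + 2).
Proof.
move=> uP wP uw u1 w1; have [pP cP] := PiP _ _ Pp.
pose a (B : {set 'I_n}) := 2 ^ #|B|.-1 - 1.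
have aE (B : {set 'I_n}) : 2 ^ #|B|.-1 = 1 + a B by rewrite /a subnKC // expn_gt0.
have a_gt0 B : B \in P -> #|B| != 1 -> 0 < a B.
  move=> BP B1; rewrite subn_gt0 -{1}(expn0 2) ltn_exp2l //.
  have := partition_neq0 pP BP; rewrite -card_gt0; lia.
apply: leq_ltn_trans (leq_card_meeting_pairs Pp (erefl _)) _.
rewrite extremal_card_add2 // -(prod_expn_blocks Pp) ltn_add2l ltn_pmul2l //.
under eq_bigr do under eq_bigr do rewrite aE.
under [X in _ < _ * (X - 1)]eq_bigr do rewrite aE.
have := @leq_sum_pairs_prod _ P a; rewrite cP addn2 /= => /(_ isT); apply: leq_trans.
rewrite -[ltnLHS]addn0 ltn_add2l muln_gt0 t_gt0 /=.
rewrite (bigD1 [set u; w]) /=; last by apply/pairsP; exists u, w.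
by rewrite big_setU1 ?inE //= big_set1 addn_gt0 muln_gt0 !a_gt0.
Qed.

Lemma leq_card_setI_of_meeting y H : y \in P ->
    (forall B, B \in P :\ y -> #|B| = 1) -> H \in meeting t (t + 2) P ->
  t <= #|(P :\ y) :&: H|.
Proof.
move=> yP P1 Hm; have [pP cP] := PiP _ _ Pp.
have [HE|HP] := eqVneq H P.
  by rewrite HE (setIidPl (subsetDl _ _)) card_setD1 // cP addn2 leqnSn.
have [A Ap sH] := meeting_pair Pp (erefl _) Hm.
have yA : y \in A.
  apply: contraNT HP => yA; suff /card_le1_eqP : #|star (Pi n (t + 2)) id (P :\: A)| <= 1.
    move=> star_eq; apply/eqP/star_eq; apply/starP; rewrite ?subsetDl //.
    by have [] := meetingP _ _ _ _ Hm.
  rewrite (card_star_pair Pp Ap) big1 // => B BA; rewrite P1 // !inE.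
  have := Ap; rewrite inE => /andP[/subsetP sAP _]; rewrite sAP // andbT.
  by apply: contraNneq yA => <-.
have := Ap; rewrite inE => /andP[sAP /eqP cA].
have <- : #|P :\: A| = t by rewrite cardsD (setIidPr sAP) cP cA addnK.
by rewrite subset_leq_card // subsetI sH setDS // sub1set.
Qed.

Lemma card_meeting_lt_or_cover :
  #|meeting t (t + 2) P| < extremal_card n t (t + 2) \/
  exists2 T : {set {set 'I_n}}, #|T| = t.+1 &
    forall H, H \in meeting t (t + 2) P -> t <= #|T :&: H|.
Proof.
have [_ cP] := PiP _ _ Pp.
have [y yP y_singletons] : exists2 y, y \in P &
    #|y| = 1 -> forall B, B \in P -> #|B| = 1.
  have [/exists_inP[y yP y1]|] := boolP [exists y in P, #|y| != 1].
    by exists y => // y1'; rewrite y1' in y1.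
  rewrite negb_exists_in => /forall_inP P1.
  have /card_gt0P[y yP] : 0 < #|P| by rewrite cP addn2.
  by exists y => // _ B /P1; rewrite negbK => /eqP.
have [/forall_inP P1|] := boolP [forall B in P :\ y, #|B| == 1].
  right; exists (P :\ y); first by rewrite card_setD1 // cP addn2.
  by move=> H; apply: leq_card_setI_of_meeting => // B /P1/eqP.
rewrite negb_forall_in => /exists_inP[w]; rewrite !inE => /andP[wy wP] w1.
left; apply: (card_meeting_two_nonsingletons_lt yP wP) => //; first by rewrite eq_sym.
by apply: contra_neqN w1 => /eqP/y_singletons ->.
Qed.

End NearSmallPartition.

(** * Cross-intersecting families of partitions *)

Lemma prod_setC1 (I : finType) (a : I) (g : I -> nat) :
  \prod_i g i = g a * \prod_(i in [set~ a]) g i.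
Proof. by rewrite (bigD1 a) //=; congr (_ * _); apply: eq_bigl => i; rewrite !inE. Qed.

Lemma disjoint_set1C (I : finType) (a : I) : [disjoint [set a] & [set~ a]].
Proof. by rewrite disjoints1 !inE eqxx. Qed.

Lemma eq_of_leq_prod (I : finType) (f g : I -> nat) : (forall i, f i <= g i) ->
  0 < \prod_i g i -> \prod_i f i = \prod_i g i -> f =1 g.
Proof.
move=> fg g_gt0 prodE i; have prodD1 h : \prod_j h j = h i * \prod_(j | j != i) h j.
  exact: bigD1.
move: g_gt0 prodE; rewrite !prodD1 muln_gt0 => /andP[_ G_gt0] prodE.
have FG : \prod_(j | j != i) f j <= \prod_(j | j != i) g j by apply: leq_prod.
by apply/eqP; rewrite eqn_leq fg /= -(leq_pmul2r G_gt0) -prodE leq_mul.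
Qed.

Section Families.

Variables (n t K : nat) (I : finType) (k : I -> nat) (F : I -> {set {set {set 'I_n}}}).
Implicit Types (a b i j l : I) (J : {set I}) (A T X G H P : {set {set 'I_n}}).
Implicit Types (f : {ffun I -> {set {set 'I_n}}}).

(* The numbers of members of [Pi n (k i)] above [t], respectively [t.+1], given singletons. *)
Local Notation V i := (stirling (n - t) (k i - t)).
Local Notation W i := (stirling (n - t.+1) (k i - t.+1)).

Hypothesis t_gt0 : 0 < t.
Hypothesis I_gt2 : 2 < #|I|.
Hypothesis tk : forall i, t + 2 <= k i.
Hypothesis kK : forall i, k i <= K.
Hypothesis nK : pow_cond n K.
Hypothesis sF : forall i, F i \subset Pi n (k i).
Hypothesis crossF : cross F [set: I] t.
Hypothesis nontrivF : forall A, #|A| = t -> exists i, exists2 G, G \in F i & ~~ (A \subset G).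

Local Lemma addn2_leq_K : t + 2 <= K.
Proof.
have /card_gt0P[i _] : 0 < #|I| by apply: leq_trans I_gt2.
exact: leq_trans (tk i) (kK i).
Qed.

Local Lemma K_ge3 : 3 <= K. Proof. by have := addn2_leq_K; lia. Qed.

Local Lemma q_gt0 : 0 < 2 * K ^ 2. Proof. by rewrite muln_gt0 expn_gt0; have := K_ge3; lia. Qed.

Local Lemma ltn_t1_K : t.+1 < K. Proof. by have := addn2_leq_K; lia. Qed.

Local Lemma addn5_leq_n : K + 5 <= n. Proof. exact: pow_cond_addn5_leq K_ge3 nK. Qed.

Local Lemma addn2_leq_n : t + 2 <= n. Proof. by have := addn5_leq_n; have := addn2_leq_K; lia. Qed.

Local Lemma ltn_k_n i : k i < n. Proof. by have := addn5_leq_n; have := kK i; lia. Qed.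

Local Lemma mem_F_Pi i G : G \in F i -> G \in Pi n (k i).
Proof. exact: (subsetP (sF i)). Qed.

Local Lemma W_gt0 i : 0 < W i.
Proof. by apply: stirling_gt0; have := addn5_leq_n; have := tk i; have := kK i; lia. Qed.

Local Lemma prod_W_gt0 J : 0 < \prod_(i in J) W i.
Proof. by apply: prodn_cond_gt0 => i _; apply: W_gt0. Qed.

Local Lemma W_eq1 i : k i = t + 2 -> W i = 1.
Proof.
move=> ->; have -> : t + 2 - t.+1 = 1 by lia.
have -> : n - t.+1 = (n - t.+2).+1 by have := addn5_leq_n; have := addn2_leq_K; lia.
exact: stirlingn1.
Qed.

Lemma leq_mul_W_V i : 2 * K ^ 2 * W i <= V i.
Proof. by apply: (stirling_growth K_ge3 nK) => //; rewrite tk kK. Qed.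

Lemma V_lt_extremal i : V i < extremal_card n t (k i).
Proof.
have := addn5_leq_n; have := tk i; have := kK i; have := leq_mul_W_V i; have := W_gt0 i.
have : 3 <= 2 * K ^ 2 by have := leq_wexp2r 2 K_ge3; lia.
move: (2 * K ^ 2) => q q_ge3 W0 qWV kK' tk' nK'.
rewrite extremal_cardE; [|lia..].
rewrite -[ltnLHS]addn0 ltn_add2l muln_gt0 t_gt0 subn_gt0; nia.
Qed.

Lemma leq_card_star_F i A : #|star (F i) id A| <= #|star (Pi n (k i)) id A|.
Proof.
apply/subset_leq_card/subsetP => G /starP[/mem_F_Pi GP sA]; exact/starP.
Qed.

Lemma card_star_F_decayV i A z : #|A| = t + z ->
  (2 * K ^ 2) ^ z * #|star (F i) id A| <= V i.
Proof.
move=> cA; apply: leq_trans (leq_mul (leqnn _) (leq_card_star_F i A)) _.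
have := @card_star_decay n K t (k i) A K_ge3 nK t_gt0; rewrite tk kK cA addKn.
by apply=> //; apply: leq_addr.
Qed.

Lemma card_star_F_decayW i A x : k i != t + 2 -> #|A| = t.+1 + x ->
  (2 * K ^ 2) ^ x * #|star (F i) id A| <= W i.
Proof.
move=> ki cA; apply: leq_trans (leq_mul (leqnn _) (leq_card_star_F i A)) _.
have := @card_star_decay n K t.+1 (k i) A K_ge3 nK (ltn0Sn t); rewrite kK cA addKn.
by apply; [have := tk i; lia | apply: leq_addr].
Qed.

Lemma card_star_F_leV i A : #|A| = t -> #|star (F i) id A| <= V i.
Proof. by move=> cA; rewrite -[leqLHS]mul1n; apply: (@card_star_F_decayV i A 0); rewrite addn0. Qed.

Lemma card_star_F_leW i A : #|A| = t.+1 -> #|star (F i) id A| <= W i.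
Proof.
move=> cA; apply: leq_trans (leq_card_star_F i A) _.
by rewrite -cA leq_card_star_card // cA; have := tk i; lia.
Qed.

Lemma prod_card_star_F_leW J A : #|A| = t.+1 ->
  \prod_(i in J) #|star (F i) id A| <= \prod_(i in J) W i.
Proof. by move=> cA; apply: leq_prod => i _; apply: card_star_F_leW. Qed.

Lemma prod_card_star_F_decay J A x c : (forall i, i \in J -> k i != t + 2) -> c <= #|J| ->
    #|A| = t.+1 + x ->
  (2 * K ^ 2) ^ (x * c) * \prod_(i in J) #|star (F i) id A| <= \prod_(i in J) W i.
Proof.
move=> large cJ cA.
apply: (@leq_trans (\prod_(i in J) ((2 * K ^ 2) ^ x * #|star (F i) id A|))); last first.
  by apply: leq_prod => i /large ki; apply: card_star_F_decayW.
rewrite big_split /= prod_nat_const -expnM leq_mul2r leq_pexp2l ?orbT //.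
  exact: q_gt0.
by rewrite leq_mul2l cJ orbT.
Qed.

Lemma card_F_ltK i G s : 0 < s -> G \in F i -> #|G| < K + s.
Proof. by move=> s_gt0 /mem_F_Pi/PiP[_ ->]; rewrite -addn1 leq_add. Qed.

Lemma card_inter_ltK J i s f : i \in J -> 0 < s -> f \in sel F J -> #|inter J f| < K + s.
Proof.
move=> iJ s_gt0 /selP[/(_ i iJ) /(card_F_ltK s_gt0) fK _]; apply: leq_ltn_trans fK.
by rewrite subset_leq_card // bigcap_inf.
Qed.

Definition strictly_bounded := exists a,
  \prod_i #|F i| < extremal_card n t (k a) * \prod_(i in [set~ a]) W i.

Definition extremal_config a T :=
  [/\ #|T| = t.+1, forall H, H \in F a -> t <= #|T :&: H|
    & forall i G, i != a -> G \in F i -> T \subset G].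

Section NonemptyFamilies.

Hypothesis F_ne : forall i, F i != set0.

Section CrossSucc.

Variable J : {set I}.
Hypothesis crossJ : cross F J t.+1.

Lemma card_F_leW_of_small b i : b \in J -> k b = t + 2 -> i \in J -> i != b -> #|F i| <= W i.
Proof.
move=> bJ kb iJ ib; have [P PF] := set0Pn _ (F_ne b); have := mem_F_Pi PF; rewrite kb => PP.
apply: leq_trans (leq_card_meetingS (tk i) addn2_leq_n PP); apply/subset_leq_card/subsetP => G GF.
by apply/meetingP; rewrite (mem_F_Pi GF) setIC; split=> //; apply: (cross_pair F_ne crossJ) ib _ _.
Qed.

Lemma prod_card_F_leW_large : 1 < #|J| -> (forall i, i \in J -> k i != t + 2) ->
  \prod_(i in J) #|F i| <= \prod_(i in J) W i.
Proof.
move=> J_gt1 large; have /card_gt0P[b bJ] : 0 < #|J| by apply: ltnW.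
have /card_gt0P[c cJb] : 0 < #|J :\ b| by rewrite card_setD1 //; lia.
have prod_set1 (g : I -> nat) : g b = \prod_(i in [set b]) g i by rewrite big_set1.
rewrite !(big_setD1 b bJ) /= (prod_set1 (fun i => #|F i|)) (prod_set1 (fun i => W i)).
apply: (leq_prod_balance F_ne (K := K) (s := t.+1)).
- exact: ltn_t1_K.
- exact: disjoint_setDr.
- by rewrite setD1K.
- by move=> f; apply: card_inter_ltK (set11 b) _.
- by move=> f; apply: card_inter_ltK cJb _.
- move=> A cA; rewrite !big_set1; apply: leq_trans (card_star_F_decayW (large b bJ) cA).
  by rewrite leq_mul // leq_wexp2r // leq_pmull.
- move=> A cA; apply: leq_trans (prod_card_star_F_decay (c := 1) _ _ cA) => [|i|].
  + by rewrite muln1 leq_mul // leq_wexp2r // leq_pmull.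
  + by rewrite inE => /andP[_ /large].
  + by apply/card_gt0P; exists c.
Qed.

Section SmallMember.

Variables b c : I.
Hypothesis bJ : b \in J.
Hypothesis kb : k b = t + 2.
Hypothesis cJb : c \in J :\ b.

Let x := excess F [set b] t.+1.
Let z := excess F (J :\ b) t.+1.

Lemma cross_setD1 : cross F ([set b] :|: (J :\ b)) t.+1. Proof. by rewrite setD1K. Qed.

Lemma card_inter_small f : f \in sel F [set b] -> #|inter [set b] f| = t.+2.
Proof.
case/sel1P => G GF ->; rewrite inter_single.
by have /PiP[_ ->] := mem_F_Pi GF; rewrite kb addn2.
Qed.

Lemma card_F_small_leq_exp : #|F b| <= K ^ x.
Proof.
have dis := disjoint_setDr [set b] J.
have := leq_prod_branch (D := K) (m := 1) F_ne ltn_t1_K dis cross_setD1 _ (leq0n _).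
rewrite big_set1 !muln1; apply=> [g|A cA]; first exact: card_inter_ltK cJb _.
by rewrite big_set1 -(W_eq1 kb) card_star_F_leW // cA addn0.
Qed.

Lemma excess_setD1_small : z <= 1.
Proof.
have [f fs] := exists_sel F_ne [set b].
have := cover_num_min (covers_inter (disjoint_setDr [set b] J) cross_setD1 fs).
by rewrite card_inter_small // /z /excess leq_subLR addn1.
Qed.

Lemma prod_setD1_small_decay : (forall i, i \in J :\ b -> k i != t + 2) ->
  (2 * K ^ 2) ^ x * \prod_(i in J :\ b) #|F i| <=
    K ^ z * 2 ^ x * \prod_(i in J :\ b) W i.
Proof.
move=> large; have q_x_gt0 : 0 < (2 * K ^ 2) ^ x by rewrite expn_gt0 q_gt0.
have dis : [disjoint J :\ b & [set b]] by rewrite disjoint_sym disjoint_setDr.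
have crJ : cross F ((J :\ b) :|: [set b]) t.+1 by rewrite setUC cross_setD1.
have := leq_prod_branch F_ne ltn_t1_K dis crJ (D := 2) _ (leqnn _).
move/(_ (\prod_(i in J :\ b) W i %/ (2 * K ^ 2) ^ x)) => prod_le.
apply: leq_trans (leq_mul (leqnn _) (prod_le _ _)) _ => [g gs|A cA|].
- by rewrite card_inter_small.
- rewrite leq_divRL // mulnC -[X in _ ^ X](muln1 x).
  by apply: prod_card_star_F_decay cA => //; apply/card_gt0P; exists c.
by rewrite mulnCA (mulnCA _ (2 ^ x)) -[leqRHS]mulnA !leq_mul // mulnC leq_trunc_div.
Qed.

Lemma prod_card_F_leW_heavy : W b < #|F b| ->
  \prod_(i in J) #|F i| <= \prod_(i in J) W i.
Proof.
move=> heavy_b; have x_gt0 : 0 < x.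
  rewrite lt0n; apply: contraTneq heavy_b => x0; have := card_F_small_leq_exp.
  by rewrite x0 expn0 (W_eq1 kb) leqNgt.
have zx : K ^ z <= K ^ x.
  by rewrite leq_pexp2l ?(leq_trans excess_setD1_small) //; apply: leq_trans K_ge3.
have q_x_gt0 : 0 < (2 * K ^ 2) ^ x by rewrite expn_gt0 q_gt0.
rewrite !(big_setD1 b bJ) /= (W_eq1 kb) mul1n -(leq_pmul2l q_x_gt0) mulnCA.
apply: leq_trans (leq_mul card_F_small_leq_exp (prod_setD1_small_decay _)) _ => [i|].
  rewrite !inE => /andP[ib iJ]; apply: contraTneq heavy_b => ki; rewrite -leqNgt.
  by apply: card_F_leW_of_small iJ ki bJ _; rewrite eq_sym.
rewrite mulnA leq_mul2r -mulnn !expnMn mulnA mulnCA [2 ^ x * _]mulnC mulnA.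
by rewrite leq_mul2r leq_mul2l zx !orbT.
Qed.

End SmallMember.

Lemma prod_card_F_leW : 1 < #|J| -> \prod_(i in J) #|F i| <= \prod_(i in J) W i.
Proof.
move=> J_gt1.
have [/exists_inP[b bJ /eqP kb]|] := boolP [exists b in J, k b == t + 2]; last first.
  by rewrite negb_exists_in => /forall_inP; apply: prod_card_F_leW_large.
have /card_gt0P[c cJb] : 0 < #|J :\ b| by rewrite card_setD1 //; lia.
have [Wb|Fb] := ltnP (W b) #|F b|; first exact: prod_card_F_leW_heavy cJb Wb.
apply: leq_prod => i iJ; have [->//|ib] := eqVneq i b.
exact: card_F_leW_of_small kb iJ ib.
Qed.

End CrossSucc.

Lemma cross_setUCr a : cross F ([set a] :|: [set~ a]) t. Proof. by rewrite setUCr. Qed.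

Lemma card_setC1_gt1 a : 1 < #|[set~ a]|. Proof. by rewrite cardsC1; lia. Qed.

Lemma setC1_neq0 a : exists c, c \in [set~ a].
Proof. by apply/card_gt0P; apply: ltnW (card_setC1_gt1 a). Qed.

Lemma leq_card_setI_inter a f H : f \in sel F [set~ a] -> H \in F a ->
  t <= #|H :&: inter [set~ a] f|.
Proof.
move=> fs HF; apply: (cross_setU1 _ _ HF fs); last exact: cross_setUCr.
by rewrite !inE eqxx.
Qed.

Lemma prod_W_setC1_small b : k b = t + 2 -> \prod_(i in [set~ b]) W i = \prod_i W i.
Proof. by move=> kb; rewrite (prod_setC1 b) W_eq1 // mul1n. Qed.

Section NoCore.

Variable a : I.
Hypothesis no_core : forall A, #|A| = t -> ~~ covers F [set a] t A.

Lemma cross_setC1_succ : cross F [set~ a] t.+1.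
Proof.
apply/forall_inP => f fs; have dis : [disjoint [set~ a] & [set a]].
  by rewrite disjoint_sym disjoint_set1C.
have cr : cross F ([set~ a] :|: [set a]) t by rewrite setUC cross_setUCr.
have cov := covers_inter dis cr fs.
rewrite ltn_neqAle (leq_covers F_ne cov) andbT.
by apply: contraTneq cov => /esym/no_core.
Qed.

Lemma prod_setC1_leW : \prod_(i in [set~ a]) #|F i| <= \prod_(i in [set~ a]) W i.
Proof. exact: prod_card_F_leW cross_setC1_succ (card_setC1_gt1 a). Qed.

Lemma strictly_bounded_of_card_lt : #|F a| < extremal_card n t (k a) -> strictly_bounded.
Proof.
move=> Fa; exists a; rewrite (prod_setC1 a).
by apply: leq_ltn_trans (leq_mul (leqnn _) prod_setC1_leW) _; rewrite ltn_pmul2r ?prod_W_gt0.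
Qed.

Lemma card_F_lt_of_cover T f : #|T| = t.+1 -> covers F [set a] t T ->
  f \in sel F [set~ a] -> ~~ (T \subset inter [set~ a] f) -> #|F a| < extremal_card n t (k a).
Proof.
move=> cT /covers1P covT fs /subsetPn[c0 c0T c0f].
have cTD c : c \in T -> #|T :\ c| = t by move=> cinT; rewrite card_setD1 // cT.
apply: (@leq_ltn_trans (V a + t * (K * W a))).
  apply: (leq_card_star_setD1 (subxx (F a)) cT c0T covT).
    by apply: card_star_F_leV; apply: cTD.
  move=> c /setD1P[c_c0 cinT]; apply: leq_trans (subset_leq_card (subsetDl _ _)) _.
  have [d dJ] := setC1_neq0 a.
  apply: (leq_card_star_step (s := t) (X := inter [set~ a] f)) => [H HF|||e eT].
  - exact: leq_card_setI_inter.
  - exact: card_inter_ltK dJ t_gt0 fs.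
  - rewrite -(cTD c cinT); apply: ltn_card_setI; apply/subsetPn; exists c0 => //.
    by rewrite !inE eq_sym c_c0.
  - by apply: card_star_F_leW; rewrite cardsU1 eT cTD.
have := addn5_leq_n; have := kK a; have := tk a; have := leq_mul_W_V a; have := W_gt0 a.
have : K + 2 <= 2 * K ^ 2 by have := K_ge3; rewrite -mulnn; nia.
move: (2 * K ^ 2) => q Kq W0 qWV tka kKa nK'.
rewrite extremal_cardE; [|lia..].
by rewrite ltn_add2l ltn_pmul2l // ltn_subRL; nia.
Qed.

Hypothesis no_cover : forall T, #|T| = t.+1 -> ~~ covers F [set a] t T.

Lemma excess_gt1 : 1 < excess F [set a] t.
Proof.
have cr : cross F [set a] t by apply: (cross_sub F_ne (subsetT _)) crossF.
have [T covT cT] := cover_num_covers cr; rewrite (cover_numE F_ne cr) in cT.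
case: (excess _ _ _) cT => [|[|//]].
  by rewrite addn0 => /no_core; rewrite covT.
by rewrite addn1 => /no_cover; rewrite covT.
Qed.

Lemma strictly_bounded_of_large_others : (forall i, i != a -> k i != t + 2) -> strictly_bounded.
Proof.
move=> large; exists a; rewrite (prod_setC1 a).
apply: (@leq_ltn_trans (V a * \prod_(i in [set~ a]) W i)); last first.
  by rewrite ltn_pmul2r ?prod_W_gt0 // V_lt_extremal.
have prod_set1 (g : I -> nat) : g a = \prod_(i in [set a]) g i by rewrite big_set1.
have [d dJ] := setC1_neq0 a; rewrite (prod_set1 (fun i => #|F i|)) (prod_set1 (fun i => V i)).
apply: (leq_prod_balance F_ne (K := K) (s := t)).
- exact: ltnW ltn_t1_K.
- exact: disjoint_set1C.
- exact: cross_setUCr.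
- by move=> f; apply: card_inter_ltK (set11 a) _.
- by move=> f; apply: card_inter_ltK dJ _.
- move=> A cA; rewrite !big_set1; apply: leq_trans (card_star_F_decayV a cA).
  by rewrite leq_mul // leq_wexp2r // leq_pmull.
- have := excess_gt1; case: (excess _ _ _) => [|[|x]] // _ A.
  rewrite addnS => cA; apply: leq_trans (prod_card_star_F_decay (c := 2) _ _ cA) => [|i|].
  + rewrite leq_mul //; apply: (@leq_trans ((K ^ 2) ^ (x.+1 * 2))); last first.
      by rewrite leq_wexp2r // leq_pmull.
    by rewrite leq_pexp2l ?expn_gt0; have := K_ge3; lia.
  + by rewrite !inE => /large.
  + exact: card_setC1_gt1.
Qed.

Lemma card_F_lt_small b : k b = t + 2 -> b != a -> k a = t + 2 ->
  #|F a| < extremal_card n t (k a).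
Proof.
move=> kb ba ka; have [P PF] := set0Pn _ (F_ne b); have := mem_F_Pi PF; rewrite kb => PP.
have sFa H : H \in F a -> H \in meeting t (t + 2) P.
  move=> HF; apply/meetingP; rewrite -ka (mem_F_Pi HF).
  by split=> //; apply: (cross_pair F_ne crossF _ _ ba PF HF); rewrite inE.
have [card_lt|[T cT covT]] := card_meeting_lt_or_cover t_gt0 addn2_leq_n PP.
  by rewrite ka; apply: leq_ltn_trans card_lt; apply/subset_leq_card/subsetP.
by have /negP[] := no_cover cT; apply/covers1P => H /sFa/covT.
Qed.

Lemma card_F_lt_mixed b : k b = t + 2 -> k a != t + 2 ->
  #|F a| < extremal_card n t (k b) * W a.
Proof.
move=> kb ka; have ba : b != a by apply: contraNneq ka => <-; apply/eqP.
have [P PF] := set0Pn _ (F_ne b); have [_ cP] := PiP _ _ (mem_F_Pi PF).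
have Fa_le : #|F a| <= 'C(t + 2, t) * V a.
  rewrite -kb -cP; apply: (leq_card_bin_star (phi := id)) => [H HF|A _].
    by apply: (cross_pair F_ne crossF _ _ ba PF HF); rewrite inE.
  exact: card_star_F_leV.
apply: leq_ltn_trans Fa_le _.
have ratio : K * V a <= V b * W a.
  rewrite [in V b]kb addKn; apply: (stirling_ratio_growth K_ge3 nK) => //.
  by rewrite kK andbT; have := tk a; lia.
have binE : 'C(t + 2, t) * 2 = (t + 2) * t.+1.
  by rewrite -bin_sub ?leq_addr // addKn (bin_ffact _ 2) ffactnS ffactn1 addn2.
have Vb_ge2 : 1 < V b.
  by have := leq_mul_W_V b; rewrite (W_eq1 kb); have := leq_wexp2r 2 K_ge3; lia.
have := addn5_leq_n; have := addn2_leq_K => tK Kn.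
rewrite extremal_cardE; [|lia..]; rewrite (W_eq1 kb) -(@ltn_pmul2r 2) // mulnAC binE.
apply: (@leq_ltn_trans (t.+1 * (K * V a))).
  by rewrite mulnA [t.+1 * K]mulnC !leq_mul2r tK !orbT.
apply: leq_ltn_trans (leq_mul (leqnn _) ratio) _.
by rewrite mulnA [ltnRHS]mulnAC ltn_pmul2r ?W_gt0 //; nia.
Qed.

Lemma strictly_bounded_no_cover : strictly_bounded.
Proof.
have [/existsP[b /andP[ba /eqP kb]]|] := boolP [exists b, (b != a) && (k b == t + 2)]; last first.
  rewrite negb_exists => /forallP large; apply: strictly_bounded_of_large_others => i ia.
  by have := large i; rewrite ia.
have [ka|ka] := eqVneq (k a) (t + 2).
  exact: strictly_bounded_of_card_lt (card_F_lt_small kb ba ka).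
exists b; rewrite prod_W_setC1_small // !(prod_setC1 a) mulnA.
apply: leq_ltn_trans (leq_mul (leqnn _) prod_setC1_leW) _.
by rewrite ltn_pmul2r ?prod_W_gt0 // card_F_lt_mixed.
Qed.

End NoCore.

Lemma strictly_bounded_or_extremal a : (forall A, #|A| = t -> ~~ covers F [set a] t A) ->
  strictly_bounded \/ exists T, extremal_config a T.
Proof.
move=> no_core.
have [/existsP[T /andP[/eqP cT covT]]|] :=
    boolP [exists T : {set {set 'I_n}}, (#|T| == t.+1) && covers F [set a] t T]; last first.
  rewrite negb_exists => /forallP no_cover; left; apply: (strictly_bounded_no_cover no_core).
  by move=> T cT; have := no_cover T; rewrite cT eqxx.
have [/forall_inP sT|] := boolP [forall f in sel F [set~ a], T \subset inter [set~ a] f].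
  right; exists T; split=> // [|i G ia GF]; first exact/covers1P.
  have [||f fs] := @sel_extend _ _ F F_ne [set i] [set~ a] (single i G).
  - by rewrite sub1set !inE.
  - exact: single_sel.
  by rewrite inter_single; apply: subset_trans (sT f fs).
rewrite negb_forall_in => /exists_inP[f fs nT]; left.
exact: (strictly_bounded_of_card_lt no_core) (card_F_lt_of_cover cT covT fs nT).
Qed.

Section CommonCores.

Variable core : I -> {set {set 'I_n}}.
Hypothesis card_core : forall i, #|core i| = t.
Hypothesis core_sub : forall i G, G \in F i -> core i \subset G.

Lemma cross_pairF i j G H : i != j -> G \in F i -> H \in F j -> t <= #|G :&: H|.
Proof. by apply: (cross_pair F_ne crossF); rewrite inE. Qed.

Lemma exists_core_missed i : exists j, exists2 H, j != i /\ H \in F j & #|core i :&: H| < t.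
Proof.
have [j [H HF nsub]] := nontrivF (card_core i).
exists j, H; last by rewrite -(card_core i); apply: ltn_card_setI.
by split=> //; apply: contraNneq nsub => ji; apply: core_sub; rewrite -ji.
Qed.

Lemma star_core i : star (F i) id (core i) = F i.
Proof. by apply/setP => G; apply/starP/idP => [[]//|GF]; rewrite GF core_sub. Qed.

Lemma card_F_leKW i : #|F i| <= K * W i.
Proof.
have [j [H [ji HF] core_lt]] := exists_core_missed i.
rewrite -star_core; apply: (leq_card_star_step (s := t) (X := H)) => // [G GF||e eA].
- by apply: cross_pairF GF HF; rewrite eq_sym.
- exact: card_F_ltK HF.
- by apply: card_star_F_leW; rewrite cardsU1 eA card_core.
Qed.

Definition heavy := [set i | W i < #|F i|].

Lemma prod_leq_of_card_heavy : #|heavy| <= 2 -> \prod_i #|F i| <= K ^ 2 * \prod_i W i.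
Proof.
move=> heavy_le2; apply: (@leq_trans (\prod_i ((if i \in heavy then K else 1) * W i))).
  apply: leq_prod => i _; case: ifPn => [_|]; first exact: card_F_leKW.
  by rewrite inE -leqNgt mul1n.
rewrite big_split /= -big_mkcond prod_nat_const leq_mul // leq_pexp2l //.
exact: leq_trans K_ge3.
Qed.

Lemma light_of_common A i : #|A| = t.+1 -> (forall G, G \in F i -> A \subset G) -> i \notin heavy.
Proof.
move=> cA sA; rewrite inE -leqNgt; apply: leq_trans (card_star_F_leW i cA).
by apply/subset_leq_card/subsetP => G GF; apply/starP; rewrite GF sA.
Qed.

Section CoverOfOthers.

Variables (a : I) (T : {set {set 'I_n}}).
Hypothesis cT : #|T| = t.+1.
Hypothesis covT : covers F [set~ a] t T.

Lemma setD1_sub_inter i j G H c : i != a -> j != a -> i != j -> G \in F i -> H \in F j ->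
  c \in T -> c \notin H -> T :\ c \subset G.
Proof.
move=> ia ja ij GF HF cinT cH.
suff : T :\ c \subset G :&: H by rewrite subsetI => /andP[].
apply: setD1_subset_of_leq_card_setI => //; first by rewrite inE negb_and cH orbT.
by rewrite cT ltnS (covers_pair F_ne covT _ _ ij GF HF) ?inE.
Qed.

Lemma full_but_two_or_common_setD1 :
  (exists b, forall i G, i != a -> i != b -> G \in F i -> T \subset G) \/
  (exists2 c, c \in T & forall i G, i != a -> G \in F i -> T :\ c \subset G).
Proof.
have [/existsP[b /forallP full]|] :=
    boolP [exists b, [forall i, (i \notin [set a; b]) ==> [forall G in F i, T \subset G]]].
  left; exists b => i G ia ib GF; apply: (forall_inP (implyP (full i) _)) GF.
  by rewrite !inE negb_or ia.
rewrite negb_exists => /forallP not_full; right.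
have miss b : exists i, exists2 G, G \in F i & [/\ i != a, i != b & ~~ (T \subset G)].
  have := not_full b; rewrite negb_forall => /existsP[i]; rewrite negb_imply negb_forall_in.
  by rewrite !inE negb_or => /andP[/andP[ia ib] /exists_inP[G GF nT]]; exists i, G.
have [i [G GF [ia _ nTG]]] := miss a; have [c cinT cG] := subsetPn nTG.
have [j [H HF [ja ji nTH]]] := miss i; exists c => // l P la PF.
have cH : c \notin H.
  apply: contra nTH => cH; rewrite -(setD1K cinT) subUset sub1set cH.
  exact: setD1_sub_inter HF GF cinT cG.
have [li|li] := eqVneq l i; last exact: setD1_sub_inter PF GF cinT cG.
by apply: setD1_sub_inter PF HF cinT cH; rewrite // li eq_sym.
Qed.

Lemma prod_leq_of_cover_of_others : \prod_i #|F i| <= K ^ 2 * \prod_i W i.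
Proof.
have [[b full]|[c cinT common]] := full_but_two_or_common_setD1.
  apply: prod_leq_of_card_heavy.
  apply: (@leq_trans #|[set a; b]|); last by rewrite cards2; case: (_ != _).
  apply/subset_leq_card/subsetP => i; apply: contraLR; rewrite !inE negb_or => /andP[ia ib].
  by have := @light_of_common T i cT; rewrite inE; apply=> G; apply: full.
have cTc : #|T :\ c| = t by rewrite card_setD1 // cT.
have [i [H HF nsub]] := nontrivF cTc.
have ia : i = a by apply/eqP; apply: contraNT nsub => ia; apply: common HF.
rewrite {}ia in HF.
have prod_le : \prod_(i in [set~ a]) #|F i| <= K * \prod_(i in [set~ a]) W i.
  rewrite (@prod_card_star_full _ _ F _ (T :\ c)) => [|j G]; last by rewrite !inE; apply: common.
  apply: (leq_card_star_step (s := t) (X := H)) => [f fs|||e eT].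
  - by rewrite setIC; apply: leq_card_setI_inter.
  - exact: card_F_ltK HF.
  - by rewrite -cTc; apply: ltn_card_setI.
  - by rewrite star_sel card_sel prod_card_star_F_leW // cardsU1 eT cTc.
rewrite !(prod_setC1 a); apply: leq_trans (leq_mul (card_F_leKW a) prod_le) _.
by rewrite mulnACA mulnn.
Qed.

End CoverOfOthers.

Section NoCoverOfOthers.

Hypothesis no_cover : forall a T, #|T| = t.+1 -> ~~ covers F [set~ a] t T.

Lemma heavy_small i : i \in heavy -> k i = t + 2.
Proof.
rewrite inE => heavy_i; apply/eqP; apply: contraTT heavy_i => ki; rewrite -leqNgt.
apply: (@leq_trans (K ^ 2 * (W i %/ (2 * K ^ 2)))); last first.
  by apply: leq_trans (leq_trunc_div _ (2 * K ^ 2)); rewrite mulnC leq_mul // leq_pmull.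
rewrite -star_core; apply: (leq_card_star_branch (s := t)) => [A sA cA|A cA]; last first.
  rewrite leq_divRL ?q_gt0 // mulnC -[2 * K ^ 2]expn1; apply: card_star_F_decayW ki _.
  by rewrite cA card_core addn2 addn1.
rewrite card_core in cA; have [At|At] := leqP #|A| t.
  have <- : core i = A by apply/eqP; rewrite eqEcard sA card_core.
  have [j [H [ji HF] core_lt]] := exists_core_missed i; exists H; split=> // [G GF|].
    by apply: cross_pairF GF HF; rewrite eq_sym.
  exact: card_F_ltK HF.
have /(no_cover i) : #|A| = t.+1 by lia.
rewrite negb_forall_in => /exists_inP[f fs]; rewrite -ltnNge => cover_lt.
have [d dJ] := setC1_neq0 i; exists (inter [set~ i] f); split=> //.
  by move=> G; apply: leq_card_setI_inter.
exact: card_inter_ltK dJ t_gt0 fs.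
Qed.

Lemma heavy_core_uniq i A : i \in heavy -> #|A| = t ->
  (forall G, G \in F i -> A \subset G) -> A = core i.
Proof.
move=> heavy_i cA sA; apply/eqP; rewrite eqEcard cA card_core leqnn andbT.
apply: contraTT heavy_i => /subsetPn[e eA eC]; apply: (@light_of_common (e |: core i)).
  by rewrite cardsU1 eC card_core.
by move=> G GF; rewrite subUset sub1set core_sub // (subsetP (sA G GF)).
Qed.

Lemma heavy_far i b P : i \in heavy -> b \in heavy -> P \in F b ->
  exists2 G, G \in F i & #|G :&: P| <= t.
Proof.
move=> heavy_i /heavy_small kb PF; apply/exists_inP; move: heavy_i; rewrite inE.
apply: contraTT; rewrite negb_exists_in -leqNgt => /forall_inP near.
have := mem_F_Pi PF; rewrite kb => PP.
apply: leq_trans (leq_card_meetingS (tk i) addn2_leq_n PP); apply/subset_leq_card/subsetP => G GF.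
by apply/meetingP; rewrite (mem_F_Pi GF) setIC ltnNge near.
Qed.

Lemma heavy_core_eq i j l : i \in heavy -> j \in heavy -> l \in heavy ->
  [/\ i != j, j != l & l != i] -> core i = core j.
Proof.
move=> heavy_i heavy_j heavy_l [ij jl li]; apply: heavy_core_uniq => // G GF.
have [H HF HG_le] := heavy_far heavy_l heavy_j GF.
suff <- : H :&: G = core i by rewrite subsetIr.
apply: heavy_core_uniq => // [|P PF].
  by apply/eqP; rewrite eqn_leq HG_le setIC; apply: cross_pairF GF HF.
apply: subset_of_leq_card_setI; apply: leq_trans HG_le _; rewrite setIC [H :&: G]setIC setIA.
by apply: (cross_triple F_ne crossF _ (And3 PF GF HF)).
Qed.

Lemma card_heavy_le2 : #|heavy| <= 2.
Proof.
rewrite leqNgt; apply/negP => /card_gt2P[i [j [l [[heavy_i heavy_j heavy_l] [ij jl li]]]]].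
have core_ij := heavy_core_eq heavy_i heavy_j heavy_l (And3 ij jl li).
have [m [H HF nsub]] := nontrivF (card_core i).
have mi : m != i by apply: contraNneq nsub => mi; apply: core_sub; rewrite -mi.
have jm : j != m by apply: contraNneq nsub => jm; rewrite core_ij; apply: core_sub; rewrite jm.
have [P PF] := set0Pn _ (F_ne j); have [G GF] := heavy_far heavy_i heavy_j PF.
rewrite leqNgt => /negP[].
have t_le := cross_triple F_ne crossF (And3 ij jm mi) (And3 GF PF HF).
have [sub|/subsetPn[e]] := boolP (G :&: P :&: H \subset core i).
  case/negP: nsub; suff /eqP <- : G :&: P :&: H == core i by rewrite subsetIr.
  by rewrite eqEcard sub card_core.
rewrite !inE => /andP[/andP[eG eP] _] e_core; rewrite -(card_core i).
apply: (@leq_trans #|e |: core i|); first by rewrite cardsU1 e_core.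
rewrite subset_leq_card // subUset sub1set subsetI inE eG eP core_sub //.
by rewrite core_ij core_sub.
Qed.

End NoCoverOfOthers.

Lemma prod_leq_of_common_cores : \prod_i #|F i| <= K ^ 2 * \prod_i W i.
Proof.
have [/existsP[a /existsP[T /andP[/eqP cT covT]]]|] := boolP [exists a,
    [exists T : {set {set 'I_n}}, (#|T| == t.+1) && covers F [set~ a] t T]].
  exact: prod_leq_of_cover_of_others cT covT.
rewrite negb_exists => /forallP no_cover.
apply: prod_leq_of_card_heavy; apply: card_heavy_le2 => a T cT.
by have := no_cover a; rewrite negb_exists => /forallP/(_ T); rewrite cT eqxx.
Qed.

Lemma strictly_bounded_common_cores : strictly_bounded.
Proof.
have /card_gt0P[a _] : 0 < #|I| by apply: leq_trans I_gt2.
exists a; apply: leq_ltn_trans prod_leq_of_common_cores _; rewrite (prod_setC1 a) mulnA.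
rewrite ltn_pmul2r ?prod_W_gt0 //; apply: leq_ltn_trans (V_lt_extremal a).
by apply: leq_trans (leq_mul_W_V a); rewrite leq_mul // leq_pmull.
Qed.

End CommonCores.

Lemma nonempty_dichotomy : strictly_bounded \/ exists a T, extremal_config a T.
Proof.
have [/existsP[a /forallP no_core]|] := boolP [exists a,
    [forall A : {set {set 'I_n}}, (#|A| == t) ==> ~~ covers F [set a] t A]].
  have [A cA||[T T_ext]] := @strictly_bounded_or_extremal a; [|by left|by right; exists a, T].
  by have := no_core A; rewrite cA eqxx.
rewrite negb_exists => /forallP cores; left.
have /fin_all_exists[core coreP] i : exists A, #|A| = t /\ forall G, G \in F i -> A \subset G.
  have := cores i; rewrite negb_forall => /existsP[A].
  rewrite negb_imply negbK => /andP[/eqP cA /covers1P covA]; exists A; split=> // G GF.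
  by apply: subset_of_leq_card_setI; rewrite cA covA.
apply: (strictly_bounded_common_cores (core := core)) => // i; first by have [] := coreP i.
by have [] := coreP i.
Qed.

End NonemptyFamilies.

Lemma extremal_config_card a T : extremal_config a T ->
  [/\ F a \subset meeting t (k a) T,
      forall i, i != a -> F i \subset star (Pi n (k i)) id T
    & forall i, i != a -> #|F i| <= W i].
Proof.
case=> cT Ta Ti; split=> [|i ia|i ia].
- by apply/subsetP => H HF; apply/meetingP; rewrite (mem_F_Pi HF) Ta.
- by apply/subsetP => G GF; apply/starP; rewrite (mem_F_Pi GF) (Ti i).
apply: leq_trans (card_star_F_leW i cT); apply/subset_leq_card/subsetP => G GF.
by apply/starP; rewrite GF (Ti i).
Qed.

Lemma extremal_config_singletons a T : extremal_config a T ->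
  strictly_bounded \/ forall B, B \in T -> #|B| = 1.
Proof.
move=> config; have [sFa _ FW] := extremal_config_card config; have [cT _ _] := config.
have [/forall_inP T1|] := boolP [forall B in T, #|B| == 1].
  by right=> B /T1/eqP.
rewrite negb_forall_in => /exists_inP[c0 c0T c0_1]; left; exists a; rewrite (prod_setC1 a).
apply: (@leq_ltn_trans (#|F a| * \prod_(i in [set~ a]) W i)).
  by rewrite leq_mul //; apply: leq_prod => i; rewrite !inE => /FW.
rewrite ltn_pmul2r ?prod_W_gt0 //; apply: leq_ltn_trans (subset_leq_card sFa) _.
apply: card_meeting_nonsingleton_lt cT c0T c0_1 _ => //.
by rewrite tk ltn_k_n.
Qed.

Lemma strictly_bounded_or_singletons : strictly_bounded \/
  exists a T, extremal_config a T /\ forall B, B \in T -> #|B| = 1.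
Proof.
have [/existsP[a /eqP Fa0]|] := boolP [exists i, F i == set0].
  left; exists a; rewrite (prod_setC1 a) Fa0 cards0 mul0n muln_gt0 prod_W_gt0 andbT.
  exact: leq_ltn_trans (V_lt_extremal a).
rewrite negb_exists => /forallP F_ne.
have [|[a [T config]]] := nonempty_dichotomy F_ne; first by left.
by have [|T1] := extremal_config_singletons config; [left | right; exists a, T].
Qed.

Section MinimalIndex.

Variable b : I.
Hypothesis kb : forall i, k b <= k i.

Local Notation bound i := (extremal_card n t (k i) * \prod_(j in [set~ i]) W j).

Lemma bound_mul_W a c : bound a * (W a * W c) = extremal_card n t (k a) * W c * \prod_i W i.
Proof. by rewrite (prod_setC1 a) [W a * W c]mulnC mulnACA [_ * W a]mulnC. Qed.

Lemma leq_bound a : bound a <= bound b.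
Proof.
have Wab : 0 < W a * W b by rewrite muln_gt0 !W_gt0.
rewrite -(leq_pmul2r Wab) bound_mul_W [W a * W b]mulnC bound_mul_W leq_mul //.
have [tn tkb] : t < n /\ t < k b by have := addn2_leq_n; have := tk b; lia.
by apply: leq_extremal_ratio; rewrite ?tkb ?kb.
Qed.

Lemma ltn_bound a : k a != k b -> bound a < bound b.
Proof.
move=> kab; have Wab : 0 < W a * W b by rewrite muln_gt0 !W_gt0.
rewrite -(ltn_pmul2r Wab) bound_mul_W [W a * W b]mulnC bound_mul_W ltn_pmul2r; last first.
  by rewrite prodn_gt0 // => i; apply: W_gt0.
have tkb : t < k b by have := tk b; lia.
apply: ltn_extremal_ratio; last exact: ltnW (ltn_k_n a).
by rewrite tkb ltn_neqAle eq_sym kab kb.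
Qed.

Definition extremal_size a i := if i == a then extremal_card n t (k a) else W i.

Lemma prod_extremal_size a : \prod_i extremal_size a i = bound a.
Proof.
rewrite (prod_setC1 a) /extremal_size eqxx; congr (_ * _).
by apply: eq_bigr => i; rewrite !inE => /negbTE ->.
Qed.

Lemma card_F_leq_extremal_size a T : extremal_config a T -> (forall B, B \in T -> #|B| = 1) ->
  forall i, #|F i| <= extremal_size a i.
Proof.
move=> config T1 i; have [sFa _ FW] := extremal_config_card config; have [cT _ _] := config.
rewrite /extremal_size; case: eqP => [->|/eqP/FW //].
apply: leq_trans (subset_leq_card sFa) _.
by apply: leq_card_meeting_singletons => //; rewrite tk ltnW // ltn_k_n.
Qed.

Lemma prod_card_F_leq_bound : \prod_i #|F i| <= bound b.
Proof.
have [[a prod_lt]|[a [T [config T1]]]] := strictly_bounded_or_singletons.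
  exact: leq_trans (ltnW prod_lt) (leq_bound a).
apply: leq_trans (leq_bound a); rewrite -prod_extremal_size.
by apply: leq_prod => i _; apply: card_F_leq_extremal_size T1 i.
Qed.

Lemma prod_card_F_eq_bound : \prod_i #|F i| = bound b ->
  exists a T, [/\ k a = k b, #|T| = t.+1, forall B, B \in T -> #|B| = 1,
    F a = meeting t (k a) T & forall i, i != a -> F i = star (Pi n (k i)) id T].
Proof.
move=> prodE; have [[a prod_lt]|[a [T [config T1]]]] := strictly_bounded_or_singletons.
  by have := leq_trans prod_lt (leq_bound a); rewrite prodE ltnn.
have F_le := card_F_leq_extremal_size config T1.
have prod_le : \prod_i #|F i| <= bound a by rewrite -prod_extremal_size leq_prod.
have kab : k a = k b.
  by apply/eqP; apply: contraLR prod_le => /ltn_bound; rewrite prodE -ltnNge.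
have cF : (fun i => #|F i|) =1 extremal_size a.
  apply: eq_of_leq_prod => //; rewrite prod_extremal_size.
    by rewrite muln_gt0 prod_W_gt0 andbT (leq_ltn_trans _ (V_lt_extremal a)).
  by apply/eqP; rewrite eqn_leq prod_le prodE leq_bound.
have [sFa sFi _] := extremal_config_card config; have [cT _ _] := config.
exists a, T; split=> // [|i ia]; apply/eqP; rewrite eqEcard.
  rewrite sFa cF /extremal_size eqxx.
  by apply: leq_card_meeting_singletons => //; rewrite tk ltnW // ltn_k_n.
rewrite sFi //= cF /extremal_size (negbTE ia) card_star_singletons // cT //.
by have := tk i; lia.
Qed.

End MinimalIndex.

End Families.

Section OrdinalIndices.

Variables (n r t : nat) (F : nat -> {set {set {set 'I_n}}}).

Lemma cross_ord_of_cross_intersecting : cross_intersecting r.+1 t F ->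
  cross (fun i : 'I_r.+1 => F i.+1) [set: 'I_r.+1] t.
Proof.
move=> crF; apply/forall_inP => f /selP[fF _]; pose G i := f (inord i.-1).
have GF i : 1 <= i <= r.+1 -> G i \in F i.
  move=> ir; have := fF (inord i.-1) (in_setT _); rewrite inordK; last by lia.
  by rewrite prednK //; case/andP: ir.
have := crF G GF; congr (_ <= #|pred_of_set _|).
rewrite /inter big_add1 big_mkord; apply: eq_big => [i|i _]; first by rewrite inE.
by rewrite /G /= inord_val.
Qed.

Lemma exists_not_subset_of_nontrivial : nontrivial r.+1 t F ->
  forall A : {set {set 'I_n}}, #|A| = t ->
  exists i : 'I_r.+1, exists2 G, G \in F i.+1 & ~~ (A \subset G).
Proof.
move=> ntF A cA; have [|] := boolP [exists i : 'I_r.+1, [exists G in F i.+1, ~~ (A \subset G)]].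
  by case/existsP => i /exists_inP[G GF nA]; exists i, G.
rewrite negb_exists => /forallP sA; move: ntF; rewrite /nontrivial ltnNge => /negP[].
rewrite -cA; apply/subset_leq_card/subsetP => B BA; rewrite inE; apply/allP => i.
rewrite mem_iota; case: i => [//|i] /= ir.
have {}ir : i < r.+1 by []; apply/forall_inP => G GF; have := sA (Ordinal ir).
by rewrite negb_exists_in => /forall_inP/(_ G GF); rewrite negbK => /subsetP; apply.
Qed.

End OrdinalIndices.

Lemma prod_setC1_ord_max r (g : nat -> nat) :
  \prod_(1 <= i < r.+1) g i = \prod_(i in [set~ (ord_max : 'I_r.+1)]) g i.+1.
Proof.
rewrite big_add1 big_mkord [RHS](eq_bigl (fun i => i != ord_max)) => [|i]; last by rewrite !inE.
rewrite [RHS]big_mkcond [RHS]big_ord_recr /= eqxx muln1.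
apply: eq_bigr => i _; rewrite ifT //.
by apply: contraTneq (ltn_ord i) => /(congr1 val) /= ->; rewrite ltnn.
Qed.

Theorem theorem1p6 (n r t : nat) (k : nat -> nat)
    (F : nat -> {set {set {set 'I_n}}}) :
  0 < n -> 0 < t -> 3 <= r ->
  (forall i j, 1 <= i -> i <= j -> j <= r -> k j <= k i) ->
  t + 2 <= k r ->
  log_cond n (k 1) ->
  (forall i, 1 <= i <= r -> F i \subset Pi n (k i)) ->
  cross_intersecting r t F ->
  nontrivial r t F ->
  (\prod_(1 <= i < r.+1) #|F i| <=
     ((t + 1) * stirling (n - t) (k r - t) - t * stirling (n - t - 1) (k r - t - 1))
     * \prod_(1 <= i < r) stirling (n - t - 1) (k i - t - 1))
  /\
  (\prod_(1 <= i < r.+1) #|F i| =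
     ((t + 1) * stirling (n - t) (k r - t) - t * stirling (n - t - 1) (k r - t - 1))
     * \prod_(1 <= i < r) stirling (n - t - 1) (k i - t - 1) ->
   exists a, exists T : {set {set 'I_n}},
     [/\ 1 <= a <= r /\ k a = k r,
         #|T| = t + 1, (forall B, B \in T -> #|B| = 1),
         F a = [set P in Pi n (k a) | t <= #|T :&: P|] &
         (forall i, 1 <= i <= r -> i != a ->
            F i = [set P in Pi n (k i) | T \subset P])]).
Proof.
move=> _ t_gt0; case: r => // r' r_ge3 k_mono tk log_n sF crF ntF.
have k_min (i : 'I_r'.+1) : k r'.+1 <= k i.+1 by apply: k_mono.
have k_max (i : 'I_r'.+1) : k i.+1 <= k 1 by apply: k_mono.
have tk' (i : 'I_r'.+1) : t + 2 <= k i.+1 := leq_trans tk (k_min i).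
have nK : pow_cond n (k 1).
  by apply: pow_cond_of_log_cond log_n; rewrite (leq_trans _ (tk' ord0)) // addn2.
have I_gt2 : 2 < #|'I_r'.+1| by rewrite card_ord.
have sF' (i : 'I_r'.+1) : F i.+1 \subset Pi n (k i.+1) by apply: sF; rewrite ltn_ord.
have crF' := cross_ord_of_cross_intersecting crF.
have ntF' := exists_not_subset_of_nontrivial ntF.
rewrite big_add1 big_mkord prod_setC1_ord_max -!subnDA !addn1.
rewrite -/(extremal_card n t (k r'.+1)).
under [X in _ * X]eq_bigr do rewrite -!subnDA !addn1.
split.
  exact: (prod_card_F_leq_bound t_gt0 I_gt2 tk' k_max nK sF' crF' ntF' (b := ord_max) k_min).
move/(prod_card_F_eq_bound t_gt0 I_gt2 tk' k_max nK sF' crF' ntF' (b := ord_max) k_min).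
case=> a [T [ka cT T1 Fa Fi]]; exists a.+1, T; split=> // [|[//|i] ir ia].
  by rewrite ltn_ord.
by apply: (Fi (Ordinal ir)); apply: contraNneq ia => <-.
Qed.
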